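(* Let $\Phi=(G,\varphi)$ be a finite complex unit gain graph of order $n$ (without loops and multiple edges). Then $r(\Phi)=r(G)-2\theta(G)$ if and only if all of the following hold: (1) the cycles (if any) of $G$ are pairwise vertex-disjoint; (2) each cycle $C_p^{\varphi}$ of $\Phi$ is of Type A and has order $p\equiv 2 \pmod 4$; (3) a series of $\delta$-transformations can transform $G$ into a crucial subgraph $G_0$ that is the disjoint union of $\theta(G)$ cycles together with some isolated vertices.
   Context: A complex unit gain graph $\Phi=(G,\varphi)$ consists of a finite simple graph $G$ (the underlying graph) with vertex set $\{v_1,\dots,v_n\}$ and a gain function $\varphi$ assigning to each oriented edge $e_{ij}$ (from $v_i$ to $v_j$, where $v_iv_j\in E(G)$) a complex number of modulus $1$, with $\varphi(e_{ji})=\overline{\varphi(e_{ij})}$. The adjacency matrix $A(\Phi)$ is the Hermitian matrix with $(i,j)$ entry $\varphi(e_{ij})$ if $v_iv_j\in E(G)$ and $0$ otherwise; $r(\Phi)$ is its rank, and $r(G)$ is the rank of the $0$-$1$ adjacency matrix of $G$. $\theta(G)=|E(G)|-|V(G)|+\omega(G)$, where $\omega(G)$ is the number of connected components. Subgraphs of $\Phi$ carry the gains of $\Phi$; a cycle $C_p^\varphi$ of $\Phi$ is a cycle of $G$ with its gains. For a gain cycle $C_p^{\varphi}$ with vertices $v_1,\dots,v_p$ in cyclic order, $\varphi(C_p)=\varphi(e_{12})\varphi(e_{23})\cdots\varphi(e_{p1})$; for $p$ even it is of Type A if $\varphi(C_p)=(-1)^{p/2}$. A $\delta$-transformation of a graph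 with a pendant vertex (vertex of degree $1$) deletes a pendant vertex together with its unique neighbour. A crucial subgraph of $G$ is a graph without pendant vertices obtained from $G$ by a series of $\delta$-transformations. *)

(* Defs.v *)
From HB Require Import structures.
From mathcomp Require Import all_boot all_order all_algebra.
From mathcomp Require Import complex.
From mathcomp Require Import reals.
Set Implicit Arguments. Unset Strict Implicit. Unset Printing Implicit Defensive.
Import Order.TTheory GRing.Theory Num.Theory.
Local Open Scope ring_scope.

Definition simple_graph (n : nat) (e : rel 'I_n) : Prop :=
  irreflexive e /\ symmetric e.

Definition unit_gain (R : rcfType) (n : nat) (e : rel 'I_n)
  (phi : 'I_n -> 'I_n -> R[i]) : Prop :=
  forall i j, e i j -> `|phi i j| = 1 /\ phi j i = (phi i j)^*.

Definition gain_adj (R : rcfType) (n : nat) (e : rel 'I_n)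
  (phi : 'I_n -> 'I_n -> R[i]) : 'M[R[i]]_n :=
  \matrix_(i, j) (if e i j then phi i j else 0).

Definition adj01 (R : rcfType) (n : nat) (e : rel 'I_n) : 'M[R[i]]_n :=
  \matrix_(i, j) (if e i j then 1 else 0).

Definition nedges (n : nat) (e : rel 'I_n) : nat :=
  #|[set p : 'I_n * 'I_n | e p.1 p.2 && (p.1 < p.2)%N]|.

Definition ncomps (n : nat) (e : rel 'I_n) : nat := n_comp e 'I_n.

Definition theta (n : nat) (e : rel 'I_n) : int :=
  (nedges e)%:Z - n%:Z + (ncomps e)%:Z.

Definition is_cycle (n : nat) (e : rel 'I_n) (c : seq 'I_n) : bool :=
  [&& (2 < size c)%N, uniq c & cycle e c].

(* Edge set of a cycle (both orientations), identifying the cycle as a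
   subgraph independently of starting point and direction. *)
Definition cycle_edges (n : nat) (c : seq 'I_n) : {set 'I_n * 'I_n} :=
  [set p : 'I_n * 'I_n | (p.1 \in c) && (p.2 == next c p.1)
                       || (p.2 \in c) && (p.1 == next c p.2)].

Definition cycle_gain (R : rcfType) (n : nat) (phi : 'I_n -> 'I_n -> R[i])
  (c : seq 'I_n) : R[i] :=
  \prod_(x <- c) phi x (next c x).

Definition typeA (R : rcfType) (n : nat) (phi : 'I_n -> 'I_n -> R[i])
  (c : seq 'I_n) : bool :=
  ~~ odd (size c) && (cycle_gain phi c == (-1) ^+ (size c)./2).

(* Subgraphs obtained by deleting vertices are induced subgraphs, represented
   by their vertex set S. *)
Definition pendant_in (n : nat) (e : rel 'I_n) (S : {set 'I_n}) (u : 'I_n) : bool :=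
  (u \in S) && (#|[set w in S | e u w]| == 1%N).

Definition delta_step (n : nat) (e : rel 'I_n) (S S' : {set 'I_n}) : Prop :=
  exists u v, [/\ pendant_in e S u, v \in S, e u v & S' = S :\ u :\ v].

Inductive delta_star (n : nat) (e : rel 'I_n) : {set 'I_n} -> {set 'I_n} -> Prop :=
  | ds_refl S : delta_star e S S
  | ds_step S S' S'' : delta_step e S S' -> delta_star e S' S'' -> delta_star e S S''.

Definition no_pendant (n : nat) (e : rel 'I_n) (S : {set 'I_n}) : Prop :=
  forall u, ~~ pendant_in e S u.

Definition union_cycles_isolated (n : nat) (e : rel 'I_n) (S : {set 'I_n})
  (cs : seq (seq 'I_n)) : Prop :=
  [/\ forall c, c \in cs -> is_cycle e c /\ {subset c <= S},
      forall i j, (i < size cs)%N -> (j < size cs)%N -> i <> j ->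
        [disjoint nth [::] cs i & nth [::] cs j]
    & forall x y, x \in S -> y \in S ->
        (e x y <-> exists2 c, c \in cs & (x, y) \in cycle_edges c)].

(* Main.v *)
(* Call an induced subgraph tight if its gain rank equals its 0-1 rank minus twice
   its cyclomatic number theta. Deleting a vertex x lowers a rank by at most 2, and
   lowers theta by at least 1 if x lies on a cycle (by at least 2 at a vertex where two
   cycles diverge); as forests have equal ranks, "<=" holds in general, and in a tight
   graph every estimate met when deleting a cycle vertex x is an equality: the gain
   rank does not change, the 0-1 rank drops by 2, theta drops by 1. Hence the cycles of
   a tight graph are disjoint, and the neighbour of a pendant vertex lies on no cycle
   (its deletion changes the gain rank), so delta-transformations preserve tightness.

   Let a tight graph have no pendant vertex. If it has no bridge, its cycles are
   components, and comparing ranks component by component settles the type and the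
   length of each cycle. If it has a bridge, a bridge with a side of minimal size
   attaches a cycle C at a single vertex x. Cutting C open next to x or at x and
   reducing the resulting paths shows that both (G - C) + x and G - C are tight, where
   x is the only pendant vertex of the former; this is impossible. *)

Require Import Defs.
From HB Require Import structures.
From mathcomp Require Import all_boot all_order all_algebra.
From mathcomp Require Import complex.
From mathcomp Require Import reals.
From mathcomp Require Import zify.
Import Order.TTheory GRing.Theory Num.Theory.
Set Implicit Arguments.
Unset Strict Implicit.
Unset Printing Implicit Defensive.
Local Open Scope ring_scope.

(** * Cyclomatic number *)

Section Cyclomatic.
Variable n : nat.
Implicit Types (e : rel 'I_n) (c : seq 'I_n).

Definition del_edge e (a b x y : 'I_n) : bool :=
  e x y && ((x, y) != (a, b)) && ((x, y) != (b, a)).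
Arguments del_edge e a b x y /.

Lemma del_edge_sub e a b : subrel (del_edge e a b) e.
Proof. by move=> x y /andP[/andP[]]. Qed.

Lemma del_edgeC e a b : del_edge e a b =2 del_edge e b a.
Proof. by move=> x y; rewrite /= -!andbA [X in _ && X]andbC. Qed.

Lemma subrel_del_edge e1 e2 a b : symmetric e1 -> subrel e1 e2 -> ~~ e1 a b ->
  subrel e1 (del_edge e2 a b).
Proof.
move=> s1 e12 N1 x y e1xy; have N1' : ~~ e1 b a by rewrite s1.
rewrite /= e12 //=; apply/andP; split; apply/eqP=> -[E1 E2];
by move: e1xy; rewrite E1 E2 ?(negbTE N1) ?(negbTE N1').
Qed.

Lemma eq_theta e1 e2 : e1 =2 e2 -> theta e1 = theta e2.
Proof.
move=> E; rewrite /theta /nedges /ncomps (eq_n_comp (eq_connect E)).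
by congr (_%:Z - _ + _); apply: eq_card => p; rewrite !inE E.
Qed.

Lemma del_edge_simple e a b : simple_graph e -> simple_graph (del_edge e a b).
Proof.
move=> [ei es]; split=> [x|x y] /=; first by rewrite ei.
by rewrite es !xpair_eqE -!andbA; congr (_ && _); rewrite andbC (andbC (y == b)) (andbC (y == a)).
Qed.

(** A path that starts outside the components of [a] and [b] stays outside them, so it never uses
    the deleted edge. *)
Lemma connect_del_edge e a b x : simple_graph e ->
  x \notin closure (del_edge e a b) (pred2 a b) ->
  connect e x =1 connect (del_edge e a b) x.
Proof.
move=> se; have [_ es'] := del_edge_simple a b se.
have sc := sym_connect_sym es'.
move=> xN y; apply/idP/idP; last first.
  by apply: connect_sub => u v /del_edge_sub; apply: connect1.
move=> /connectP[p]; elim: p x xN => [|z p IHp] x xN /=.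
  by move=> _ ->; apply: connect0.
move=> /andP[exz ep] yE.
have xz : del_edge e a b x z.
  rewrite /= exz !xpair_eqE /=; apply/andP; split; apply/negP=> /andP[/eqP E _];
  by case/negP: xN; apply: mem_closure; rewrite E !inE eqxx ?orbT.
apply: connect_trans (connect1 xz) _.
by apply: IHp => //; rewrite -(closure_closed sc _ xz).
Qed.

(** Components are counted separately inside and outside the closure of [a] and [b]: outside nothing
    changes, inside there is one component before the deletion and one or two after it. *)
Lemma ncomps_del_edge e a b : simple_graph e -> e a b ->
  ncomps (del_edge e a b) = (ncomps e + ~~ connect (del_edge e a b) a b)%N.
Proof.
move=> se eab; set e' := del_edge e a b.
have se' := del_edge_simple a b se.
have sc := sym_connect_sym (proj2 se); have sc' := sym_connect_sym (proj2 se').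
rewrite /ncomps (n_compC (closure e' (pred2 a b)) e').
rewrite (n_compC (closure e (pred2 a b)) e) !n_comp_closure2 // (connect1 eab) /=.
have clE : closure e (pred2 a b) =i closure e' (pred2 a b).
  move=> x; apply/idP/idP; last first.
    rewrite unfold_in /= => /pred0Pn[y /= /andP[xy yab]].
    rewrite unfold_in; apply/pred0Pn; exists y; apply/andP; split; last exact: yab.
    by move: xy; apply: connect_sub => u v /del_edge_sub; apply: connect1.
  apply: contraTT => xN; rewrite unfold_in negbK.
  rewrite (eq_disjoint (connect_del_edge se xN)).
  by move: xN; rewrite unfold_in negbK.
suff -> : n_comp e' [predC closure e' (pred2 a b)] =
          n_comp e [predC closure e (pred2 a b)].
  by rewrite add1n !addSn addnC.
rewrite /n_comp_mem; apply: eq_card => x; rewrite !inE /= clE.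
case: (boolP (x \in closure e' _)) => xN; first by rewrite !andbF.
congr (_ && _); rewrite /fingraph.roots /fingraph.root.
by rewrite -(eq_pick (connect_del_edge se xN)).
Qed.

Lemma nedges_del_edge e a b : simple_graph e -> e a b ->
  nedges e = (nedges (del_edge e a b)).+1.
Proof.
move=> [ei es].
wlog ab : a b / (a < b)%N => [W eab|eab].
  case: (ltngtP a b) => [ab|ba|E]; first exact: W.
    rewrite (W b a) // 1?es // /nedges; congr _.+1; apply: eq_card => p.
    by rewrite !inE /= -!andbA [((_ != _) && _)]andbCA.
  by move: eab; rewrite (val_inj E) ei.
rewrite /nedges (cardsD1 (a, b)) inE /= eab ab /= add1n; congr _.+1.
apply: eq_card => -[x y]; rewrite !inE /=.
case: (altP ((x, y) =P (a, b))) => [_|_]; first by rewrite /= !andbF.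
case: (altP ((x, y) =P (b, a))) => [[-> ->]|_]; last by rewrite !andbT.
by rewrite andbF /= ltnNge ltnW ?andbF.
Qed.

Lemma theta_del_edge e a b : simple_graph e -> e a b ->
  theta e = theta (del_edge e a b) + (connect (del_edge e a b) a b : nat)%:Z.
Proof.
move=> se eab; rewrite /theta (nedges_del_edge se eab) (ncomps_del_edge se eab).
by case: connect => /=; lia.
Qed.

Lemma is_cycle_sub e e' c : {in c &, subrel e e'} -> is_cycle e c -> is_cycle e' c.
Proof.
move=> ee' /and3P[s u cy]; apply/and3P; split=> //.
by apply: (sub_in_cycle (P := [in c])) cy; [exact: ee' | apply/allP].
Qed.

Lemma in_cycle_edges c x y : ((x, y) \in cycle_edges c) =
  (x \in c) && (y == next c x) || (y \in c) && (x == next c y).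
Proof. by rewrite inE. Qed.

Lemma cycle_edgesC c x y : ((x, y) \in cycle_edges c) = ((y, x) \in cycle_edges c).
Proof. by rewrite !inE orbC. Qed.

Lemma cycle_edges_mem c x y : (x, y) \in cycle_edges c -> (x \in c) && (y \in c).
Proof.
by rewrite inE /= => /orP[] /andP[xc /eqP ->]; rewrite mem_next xc.
Qed.

Lemma cycle_edges_rot k c : uniq c -> cycle_edges (rot k c) = cycle_edges c.
Proof. by move=> uc; apply/setP=> p; rewrite !inE !mem_rot !next_rot. Qed.

Lemma is_cycle_rot k e c : is_cycle e (rot k c) = is_cycle e c.
Proof. by rewrite /is_cycle size_rot rot_uniq rot_cycle. Qed.

Lemma is_cycle_edge e c x y : symmetric e -> is_cycle e c ->
  (x, y) \in cycle_edges c -> e x y.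
Proof.
move=> es /and3P[_ _ cy]; rewrite inE /= => /orP[] /andP[xc /eqP ->].
  exact: next_cycle.
by rewrite es; apply: next_cycle.
Qed.

Lemma next_last (x : 'I_n) (p : seq 'I_n) : uniq (x :: p) -> next (x :: p) (last x p) = x.
Proof.
move=> u; rewrite next_nth mem_last.
have -> : index (last x p) (x :: p) = size p.
  by rewrite (last_nth x) index_uniq //=.
by rewrite nth_default.
Qed.

(** A repetition-free path from [a] to [b] that avoids the edge is closed up by it. With the
    converse below, an edge is a bridge exactly when it lies on no cycle. *)
Lemma del_edge_connect_cycle e a b : simple_graph e -> e a b ->
  connect (del_edge e a b) a b ->
  exists2 c, is_cycle e c & (a, b) \in cycle_edges c.
Proof.
move=> [ei es] eab /connectP[p pp lp].
case: (shortenP pp) lp => q pq uq _ lq.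
exists (a :: q); last first.
  by rewrite in_cycle_edges lq mem_last next_last // eqxx orbT.
apply/and3P; split=> //.
  case: q lq pq uq => [|y [|z q]] //= lq; first by rewrite lq ei in eab.
  by rewrite lq eqxx andbF.
rewrite /= rcons_path -lq es eab andbT.
by apply: sub_path pq => u v /del_edge_sub.
Qed.

(** Rotated to start at [b], the successor of [a], the cycle is a path ending at [a]. Its first edge
    avoids [a] because there is a third vertex; the later edges avoid [b]. *)
Lemma cycle_del_edge_connect e c a b : simple_graph e -> is_cycle e c ->
  (a, b) \in cycle_edges c -> connect (del_edge e a b) a b.
Proof.
move=> se.
have sc := sym_connect_sym (proj2 (del_edge_simple a b se)).
wlog bn : a b sc / (a \in c) && (b == next c a).
  move=> W cy; rewrite inE /= => /orP[H|H]; first by apply: W; rewrite // inE /= H.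
  have sc' := sym_connect_sym (proj2 (del_edge_simple b a se)).
  by rewrite sc (eq_connect (del_edgeC e a b)); apply: W; rewrite // inE /= H.
case/andP: bn => ac /eqP bE cy _; rewrite sc.
have bc : b \in c by rewrite bE mem_next.
have [k s rE] := rot_to bc.
have uc : uniq c by case/and3P: cy.
have ab : next (b :: s) a = b by rewrite -rE next_rot.
have ur : uniq (b :: s) by rewrite -rE rot_uniq.
have asr : a \in b :: s by rewrite -rE mem_rot.
have lE : last b s = a by apply: (can_inj (prev_next ur)); rewrite ab next_last.
move: cy; rewrite -(is_cycle_rot k) rE => /and3P[].
case: s lE ur {rE ab asr} => [|y [|z s]] // lE ur _ _.
rewrite /cycle rcons_path => /andP[ep _].
apply/connectP; exists (y :: z :: s) => //.
move: ep; rewrite [path e _ _]/= [path (del_edge _ _ _) _ _]/= => /and3P[eby eyz ep].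
have aN : a != y.
  rewrite -lE /=; apply/eqP=> E; move: ur => /= /and3P[_ + _].
  by rewrite -E mem_last.
have bN : forall w, w \in y :: z :: s -> w != b.
  by move=> w ws; apply/eqP=> E; move: ur; rewrite /= -E -[_ && _]/(uniq (w :: y :: z :: s)) /= ws.
have P : path (del_edge e a b) y (z :: s).
  apply: (@sub_in_path _ (predC1 b) e); last by rewrite /= eyz.
    move=> u v; rewrite !inE => ub vb euv; rewrite /= euv !xpair_eqE.
    by rewrite (negbTE ub) (negbTE vb) andbF.
  by apply/allP=> w ws; rewrite inE bN.
move: P => /= /andP[-> ->]; rewrite !andbT eby !xpair_eqE /= eq_sym.
by rewrite (eq_sym y a) (negbTE aN) andbF andbT; apply/nandP; right; rewrite bN // inE eqxx.
Qed.

(** The edges of [e2] missing from [e1] are deleted one at a time; each lowers [theta] by 0 or 1,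
    and by 0 when it lies on no cycle. *)
Lemma theta_sub e1 e2 : simple_graph e1 -> simple_graph e2 -> subrel e1 e2 ->
  theta e1 <= theta e2 /\
  ((forall x y c, is_cycle e2 c -> (x, y) \in cycle_edges c -> e1 x y) ->
   theta e1 = theta e2).
Proof.
move=> s1; move mE: #|[set p | e2 p.1 p.2 && ~~ e1 p.1 p.2]| => m.
elim/ltn_ind: m e2 mE => m IHm e2 mE s2 e12.
case: (pickP [pred p | e2 p.1 p.2 && ~~ e1 p.1 p.2]) => [[a b] /= /andP[e2ab N1]|no0].
  have [|||le eq] := IHm #|[set p | del_edge e2 a b p.1 p.2 && ~~ e1 p.1 p.2]| _
    (del_edge e2 a b) erefl.
  - rewrite -mE; apply: proper_card; apply/properP; split.
      by apply/subsetP=> -[x y]; rewrite !inE => /andP[/del_edge_sub /= -> ->].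
    by exists (a, b); rewrite !inE /= ?e2ab ?N1 // eqxx.
  - exact: del_edge_simple.
  - by apply: subrel_del_edge => //; case: s1.
  rewrite (theta_del_edge s2 e2ab); split=> [|noc].
    by apply: le_trans le _; rewrite lerDl.
  case: (boolP (connect _ a b)) => [/(del_edge_connect_cycle s2 e2ab)[c cy cab]|_].
    by rewrite (noc _ _ _ cy cab) in N1.
  rewrite addr0; apply: eq => x y c cy; apply: noc.
  by apply: is_cycle_sub cy => u v _ _; apply: del_edge_sub.
have -> : theta e1 = theta e2; last by [].
apply: eq_theta => x y; apply/idP/idP; first exact: e12.
by move=> e2xy; have := no0 (x, y); rewrite /= e2xy /= => /negbFE.
Qed.

(** The missing cycle edge is deleted first, at the cost of one; deleting the others cannot raise
    [theta]. *)
Lemma theta_del_cycle e1 e2 c a b : simple_graph e1 -> simple_graph e2 ->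
  subrel e1 e2 -> is_cycle e2 c -> (a, b) \in cycle_edges c -> ~~ e1 a b ->
  theta e1 + 1 <= theta e2.
Proof.
move=> s1 s2 e12 cy cab N1.
have e2ab := is_cycle_edge (proj2 s2) cy cab.
rewrite (theta_del_edge s2 e2ab) (cycle_del_edge_connect s2 cy cab) lerD2r.
have [|le _] // := theta_sub s1 (del_edge_simple a b s2).
by apply: subrel_del_edge => //; case: s1.
Qed.

Lemma theta_no_edge e : (forall x y, ~~ e x y) -> theta e = 0.
Proof.
move=> noe; rewrite /theta.
have -> : nedges e = 0%N.
  apply/eqP; rewrite cards_eq0; apply/eqP/setP=> p.
  by rewrite !inE (negbTE (noe _ _)).
have -> : ncomps e = n; last by rewrite sub0r addNr.
rewrite /ncomps /n_comp_mem -[RHS]card_ord; apply: eq_card => x; rewrite !inE andbT.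
rewrite /fingraph.roots; have := @connect_root _ e x.
case/connectP=> -[|y p] /=; last by rewrite (negbTE (noe _ _)).
by move=> _ ->; rewrite eqxx.
Qed.

(** Otherwise both cycles have the same edges at each common vertex, so a walk along either of them
    from a common vertex never leaves the other, and the edge sets agree. *)
Lemma cycles_diverge c1 c2 : uniq c1 -> uniq c2 -> cycle_edges c1 <> cycle_edges c2 ->
  ~~ [disjoint c1 & c2] ->
  exists x y, [/\ x \in c1, x \in c2 &
    ((x, y) \in cycle_edges c1) (+) ((x, y) \in cycle_edges c2)].
Proof.
move=> u1 u2 ne /pred0Pn[x0 /= /andP[x01 x02]].
case: (boolP [exists p, [&& p.1 \in c1, p.1 \in c2 &
   (p \in cycle_edges c1) (+) (p \in cycle_edges c2)]]).
  by case/existsP=> -[x y] /and3P[/= ? ? ?]; exists x, y.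
rewrite negb_exists => /forallP H.
have K x y : x \in c1 -> x \in c2 -> ((x, y) \in cycle_edges c1) = ((x, y) \in cycle_edges c2).
  move=> h1 h2; have := H (x, y); rewrite /= h1 h2 /=; do 2!case: (_ \in _) => //.
have sub c c' : uniq c -> x0 \in c -> x0 \in c' ->
   (forall x y, x \in c -> x \in c' -> ((x, y) \in cycle_edges c) = ((x, y) \in cycle_edges c')) ->
   {subset c <= c'}.
  move=> uc xc xc' E z zc.
  have := connect_cycle (cycle_next uc) xc zc.
  case/connectP=> p; elim: p (x0) xc xc' => [|w p IHp] x xc xc' /=; first by move=> _ ->.
  case/andP=> /eqP wE pp zE; apply: (IHp w) => //; first by rewrite -wE mem_next.
  have: (x, w) \in cycle_edges c by rewrite inE /= xc wE eqxx.
  by rewrite E // => /cycle_edges_mem/andP[].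
have s12 := sub _ _ u1 x01 x02 K.
have s21 : {subset c2 <= c1} by apply: (sub _ _ u2 x02 x01) => x y h2 h1; rewrite K.
case: ne; apply/setP=> -[x y].
case: (boolP (x \in c1)) => xc; first by rewrite K // s12.
transitivity false; [|symmetry]; apply/negbTE/negP=> /cycle_edges_mem/andP[h _].
  by rewrite h in xc.
by rewrite s21 in xc.
Qed.

End Cyclomatic.

Arguments del_edge [n] e a b x y /.

(** * Ranks *)

Section VertexDeletionRank.
Variables (F : fieldType) (n : nat).
Implicit Types (M : 'M[F]_n) (y : 'I_n).

(** The projection that kills coordinate [y]. Applied on both sides it clears row and column [y],
    which models vertex deletion in matrices of constant size. *)
Definition keep y : 'M[F]_n := 1%:M - delta_mx y y.

Lemma keep_entry M y i j :
  (keep y *m M *m keep y) i j = if (i == y) || (j == y) then 0 else M i j.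
Proof.
have kE : keep y = diag_mx (\row_k (k != y)%:R).
  apply/matrixP=> a b; rewrite !mxE; case: (altP (a =P b)) => [<-|ab].
    by rewrite andbb; case: (a == y); rewrite ?subrr ?subr0.
  case: (altP (a =P y)) => [E|_]; rewrite ?subr0 //=.
  by rewrite -E eq_sym (negbTE ab) subr0.
rewrite kE mul_diag_mx mul_mx_diag !mxE.
by case: (i == y); case: (j == y); rewrite /= ?mul0r ?mulr0 ?mul1r ?mulr1.
Qed.

Lemma rank_keep_le M y : (\rank (keep y *m M *m keep y) <= \rank M)%N.
Proof. exact: leq_trans (mxrankM_maxl _ _) (mxrankM_maxr _ _). Qed.

Lemma rank_le_keep M y : (\rank M <= \rank (keep y *m M *m keep y) + 2)%N.
Proof.
have d1 : (\rank (delta_mx y y : 'M[F]_n) <= 1)%N by rewrite mxrank_delta.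
have E : M = keep y *m M *m keep y + (keep y *m M *m delta_mx y y + delta_mx y y *m M).
  rewrite addrA -mulmxDr subrK mulmx1 -mulmxDl subrK mul1mx //.
rewrite {1}E; apply: leq_trans (mxrank_add _ _) _; rewrite leq_add2l.
apply: leq_trans (mxrank_add _ _) _; rewrite -[2%N]/(1 + 1)%N; apply: leq_add.
  exact: leq_trans (mxrankM_maxr _ _) d1.
exact: leq_trans (mxrankM_maxl _ _) d1.
Qed.

Lemma keep_delta y : keep y *m (delta_mx y 0 : 'cV_n) = 0.
Proof. by rewrite mulmxBl mul1mx mul_delta_mx subrr. Qed.

Lemma row_mul_delta (x : 'rV[F]_n) y : x *m delta_mx y y = x 0 y *: delta_mx 0 y.
Proof.
apply/rowP=> j; rewrite !mxE (bigD1 y) //= big1 ?addr0 => [|i iy].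
  by rewrite !mxE eqxx.
by rewrite mxE (negbTE iy) mulr0.
Qed.

(** A left kernel vector with nonzero entry at [y] makes row [y] a combination of the other rows,
    and [ze] does the same for column [y]. *)
Lemma rank_eq_keep M y (xi : 'rV[F]_n) (ze : 'cV[F]_n) :
  xi *m M = 0 -> xi 0 y != 0 -> M *m ze = 0 -> ze y 0 != 0 ->
  \rank M = \rank (keep y *m M *m keep y).
Proof.
have half (N : 'M[F]_n) (x : 'rV[F]_n) : x *m N = 0 -> x 0 y != 0 ->
    exists K, N = K *m (keep y *m N).
  (* [K] fixes [N] because [x] is in its left kernel, and column [y] of [K] vanishes by the choice
     of the scalar. *)
  move=> xN xy; pose K : 'M[F]_n := 1%:M - (x 0 y)^-1 *: (delta_mx y 0 *m x).
  exists K; have KN : K *m N = N.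
    by rewrite mulmxBl mul1mx -scalemxAl -mulmxA xN mulmx0 scaler0 subr0.
  have Kd : K *m delta_mx y y = 0.
    rewrite mulmxBl mul1mx -scalemxAl -mulmxA row_mul_delta.
    by rewrite -scalemxAr mul_delta_mx scalerA mulVf // scale1r subrr.
  by rewrite mulmxA /keep mulmxBr mulmx1 Kd subr0 KN.
move=> xM xy Mz zy.
have [K KE] := half _ _ xM xy.
have [L LE] : exists L, M^T = L *m (keep y *m M^T).
  apply: (half _ ze^T); first by rewrite -trmx_mul Mz trmx0.
  by rewrite mxE.
have kT : (keep y)^T = keep y by rewrite /keep linearB /= trmx1 trmx_delta.
have E : M = K *m (keep y *m M *m keep y) *m L^T.
  rewrite -{1}[M]trmxK LE !trmx_mul trmxK kT mulmxA {1}KE.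
  by rewrite !mulmxA.
apply/eqP; rewrite eqn_leq rank_keep_le andbT {1}E.
exact: leq_trans (mxrankM_maxl _ _) (mxrankM_maxr _ _).
Qed.

(** The row spaces form a strict chain: that of the cleared matrix [N], then the same with the unit
    vector [d] added, then that of [M]. *)
Lemma rank_keepD2 M y (xi : 'rV[F]_n) (ze : 'cV[F]_n) :
  xi *m M = delta_mx 0 y -> M *m ze = delta_mx y 0 -> ze y 0 = 0 ->
  \rank M = (\rank (keep y *m M *m keep y) + 2)%N.
Proof.
move=> xM Mz zy; set N := keep y *m M *m keep y.
apply/eqP; rewrite eqn_leq rank_le_keep /= -/N.
pose d : 'rV[F]_n := delta_mx 0 y.
have dM : (d <= M)%MS by rewrite /d -xM submxMl.
have NM : (N <= M)%MS.
  rewrite /N mulmxBr mulmx1 addmx_sub ?submxMl // eqmx_opp.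
  have -> : delta_mx y y = delta_mx y 0 *m d by rewrite mul_delta_mx.
  by rewrite mulmxA (submx_trans (submxMl _ _)).
have kz : keep y *m ze = ze.
  rewrite mulmxBl mul1mx (_ : delta_mx y y *m ze = 0) ?subr0 //.
  apply/colP=> i; rewrite !mxE big1 // => k _; rewrite mxE.
  by case: (altP (k =P y)) => [->|_]; rewrite ?zy ?mulr0 // andbF mul0r.
(* Every row of [N] vanishes at [y], whereas [d] does not. *)
have lt1 : (N < N + d)%MS.
  rewrite ltmxE addsmxSl /=; apply/negP=> /(submx_trans (addsmxSr _ _)) /submxP[D DE].
  have /rowP/(_ y) : d = D *m N := DE.
  rewrite /d /N mulmxA mulmxA [X in _ = X -> _]mxE (bigD1 y) //= big1 ?addr0; last first.
    by move=> k ky; rewrite !mxE (negbTE ky) subr0 mulr0.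
  by rewrite !mxE !eqxx subrr mulr0 => /eqP; rewrite oner_eq0.
(* Pairing with [ze] annihilates [N] and [d], since [ze] vanishes at [y], but sends row [y] of [M]
   to 1. *)
have lt2 : (N + d < M)%MS.
  rewrite ltmxE addsmx_sub NM dM /=; apply/negP=> MN.
  have : (d *m M <= N + d)%MS by exact: submx_trans (submxMl _ _) MN.
  case/sub_addsmxP=> -[u v] /= E.
  have : d *m M *m ze = 0.
    rewrite E mulmxDl -!mulmxA kz Mz keep_delta mulmx0 add0r.
    have -> : d *m ze = 0; last by rewrite mulmx0.
    by rewrite -rowE; apply/rowP=> j; rewrite !mxE !ord1.
  rewrite -mulmxA Mz mul_delta_mx => /matrixP/(_ 0 0)/eqP.
  by rewrite !mxE eqxx oner_eq0.
by rewrite addn2; apply: leq_ltn_trans (rank_ltmx lt1) (rank_ltmx lt2).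
Qed.

End VertexDeletionRank.

(** * Induced subgraphs, chains, and cycles that are components *)

Section Induced.
Variables (n : nat) (e : rel 'I_n).
Hypothesis se : simple_graph e.
Implicit Types (S T : {set 'I_n}) (c q : seq 'I_n).

Definition induced S (x y : 'I_n) : bool := [&& e x y, x \in S & y \in S].

Lemma induced_simple S : simple_graph (induced S).
Proof.
case: se => ei es; split=> [x|x y]; rewrite /induced; first by rewrite ei.
by rewrite es [X in _ && X]andbC.
Qed.

Lemma induced_setT : induced setT =2 e.
Proof. by move=> x y; rewrite /induced !inE !andbT. Qed.

Lemma induced_cycle S c : is_cycle (induced S) c <-> is_cycle e c /\ {subset c <= S}.
Proof.
split=> [cy|[cy sub]]; last first.
  by apply: is_cycle_sub cy => x y xc yc exy; apply/and3P; rewrite exy !sub.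
split; first by apply: is_cycle_sub cy => x y _ _ /and3P[].
move=> x xc; case/and3P: cy => _ _ cy.
by have /and3P[] := next_cycle cy xc.
Qed.

Lemma induced_cycle_sub S T c : S \subset T -> is_cycle (induced S) c -> is_cycle (induced T) c.
Proof.
move=> /subsetP ST /induced_cycle[cy sub]; apply/induced_cycle; split=> // x /sub.
exact: ST.
Qed.

Lemma pendant_uniq S u v : pendant_in e S u -> v \in S -> e u v ->
  forall w, w \in S -> e u w -> w = v.
Proof.
case/andP=> _ /cards1P[z zE] vS euv w wS euw.
have: w \in [set z] by rewrite -zE inE wS.
have: v \in [set z] by rewrite -zE inE vS.
by rewrite !inE => /eqP-> /eqP->.
Qed.

Lemma pendantI S u v : u \in S -> v \in S -> e u v ->
  (forall w, w \in S -> e u w -> w = v) -> pendant_in e S u.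
Proof.
move=> uS vS euv H; rewrite /pendant_in uS; apply/cards1P; exists v.
apply/setP=> w; rewrite !inE; apply/andP/eqP=> [[]|->] //; exact: H.
Qed.

(** Without [v] the vertex [u] is isolated, so deleting it as well changes no edge. *)
Lemma induced_pendant S u v : pendant_in e S u -> v \in S -> e u v ->
  induced (S :\ u :\ v) =2 induced (S :\ v).
Proof.
move=> pu vS euv x y; have N := pendant_uniq pu vS euv.
rewrite /induced !inE; case: (altP (x =P u)) => [->|xu] /=.
  rewrite !andbF /=.
  case: (boolP (e u y)) => //= euy; case: (boolP (y \in S)) => yS; last by rewrite !andbF.
  by rewrite (N y) // eqxx !andbF.
case: (altP (y =P u)) => [->|yu] //=; rewrite !andbF (proj2 se).
case: (boolP (e u x)) => //= eux; case: (boolP (x \in S)) => xS; last by rewrite andbF.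
by rewrite (N x) // eqxx.
Qed.

Lemma pendantE S u : pendant_in e S u -> exists v, [/\ u \in S, v \in S & e u v].
Proof.
case/andP=> uS /cards1P[v vE]; exists v.
by have := set11 v; rewrite -vE inE => /andP[].
Qed.

(* A path whose vertices can be removed two by two by delta-transformations,
   from the front: all other edges at a vertex, bar the last one, lead back. *)
Definition chain S q : Prop :=
  [/\ uniq q, {subset q <= S}, sorted e q &
      forall s a b t, q = s ++ [:: a, b & t] ->
        forall w, w \in S -> e a w -> w = b \/ w \in s].

Lemma chain_prefix S q1 q2 : chain S (q1 ++ q2) -> chain S q1.
Proof.
case=> uq sq pq H; split.
- by move: uq; rewrite cat_uniq => /andP[].
- by move=> x xq; apply: sq; rewrite mem_cat xq.
- by case: q1 pq {uq sq H} => //= x q1; rewrite cat_path => /andP[].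
- move=> s a b t qE; apply: (H s a b (t ++ q2)); by rewrite qE -catA.
Qed.

(** The first vertex of a chain is pendant and the second is its neighbour; deleting both leaves a
    shorter chain. *)
Lemma chain_delta_star S q : chain S q -> ~~ odd (size q) ->
  delta_star e S (S :\: [set x in q]).
Proof.
have nil S' : delta_star e S' (S' :\: [set x in [::]]).
  by rewrite (_ : _ :\: _ = S'); [left | apply/setP=> x; rewrite !inE].
move kE: (size q)./2 => k; elim: k q S kE => [|k IHk] [|a [|b q]] S kE cq oq //.
move: kE oq => /= [kE]; rewrite negbK => od; case: cq => uq sq pq H.
have aS : a \in S by apply: sq; rewrite inE eqxx.
have bS : b \in S by apply: sq; rewrite !inE eqxx orbT.
have /andP[eab pbq] : e a b && path e b q by [].
have N w : w \in S -> e a w -> w = b.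
  by move=> wS eaw; case: (H [::] a b q erefl w wS eaw).
apply: (@ds_step _ _ S (S :\ a :\ b)).
  by exists a, b; split=> //; apply: (pendantI aS bS).
have -> : S :\: [set x in [:: a, b & q]] = (S :\ a :\ b) :\: [set x in q].
  apply/setP=> x; rewrite !inE !negb_or.
  by case: (x == a); case: (x == b); rewrite /= ?andbF.
move: uq; rewrite /= inE negb_or => /and3P[/andP[ab aq] bq uq].
apply: IHk => //; split=> //.
- move=> x xq; rewrite !inE sq ?inE ?xq ?orbT // andbT.
  by apply/andP; split; apply/eqP=> E; move: xq; rewrite E ?(negbTE aq) ?(negbTE bq).
- by case: q pbq {kE sq pq H od aq bq uq} => //= x q /andP[].
- move=> s a' b' t qE w; rewrite !inE => /and3P[wb wa wS] ea'w.
  case: (H [:: a, b & s] a' b' t _ w wS ea'w) => [|->|]; first by rewrite qE.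
    by left.
  by rewrite !inE (negbTE wb) (negbTE wa); right.
Qed.

(** For a chain of odd length the last vertex survives, but all its neighbours are gone; [T] may
    thus have one isolated vertex more than the complement of [q]. *)
Lemma chain_closed_delta_star S q x : chain S q ->
  (forall w, w \in S -> e (last x q) w -> w \in q) ->
  exists T, [/\ delta_star e S T, induced T =2 induced (S :\: [set x in q]) &
                #|S| = (#|T| + (size q)./2.*2)%N].
Proof.
move=> cq lq.
have card q' : chain S q' -> (#|S| = #|S :\: [set x in q']| + size q')%N.
  case=> uq sq _ _; rewrite -(cardsID [set x in q'] S) addnC; congr (_ + _)%N.
  rewrite -(card_uniqP uq); apply: eq_card => z; rewrite !inE.
  by case: (boolP (z \in q')) => [/sq->|]; rewrite ?andbF.
case: (boolP (odd (size q))) => oq; last first.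
  exists (S :\: [set x in q]); split=> //; first exact: chain_delta_star.
  by rewrite even_halfK // -card.
case: (lastP q) oq cq lq => // q' l; rewrite size_rcons /= last_rcons => oq cq lq.
have cq' : chain S q' by move: cq; rewrite -cats1; apply: chain_prefix.
exists (S :\: [set x in q']); split; first exact: chain_delta_star; last first.
  by rewrite uphalf_half (negbTE oq) add0n even_halfK // -card.
have N w : w \in S -> w \notin q' -> ~~ e l w.
  move=> wS wq; apply/negP=> elw; have := lq w wS elw; rewrite mem_rcons inE (negbTE wq) orbF.
  by move=> /eqP E; move: elw; rewrite E (proj1 se).
move=> a b; rewrite /induced !inE !mem_rcons !inE !negb_or.
case: (altP (a =P l)) => [->|al] /=.
  rewrite !andbF /=; apply/negbTE/negP=> /and3P[elb _ /andP[bq bS]].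
  by move: elb; rewrite (negbTE (N _ bS bq)).
case: (altP (b =P l)) => [->|bl] //=.
rewrite !andbF /=; apply/negbTE/negP=> /and3P[eal /andP[aq aS] _].
by move: eal; rewrite (proj2 se) (negbTE (N _ aS aq)).
Qed.

(** A cycle cut open at a vertex [x] outside [S] becomes a chain. Edges that leave the cycle are
    allowed at its last vertex only, where [chain] demands nothing. *)
Lemma cycle_chain S x q : is_cycle e (x :: q) -> {subset q <= S} -> x \notin S ->
  (forall a, a \in q -> a != last x q -> forall w, w \in S -> e a w ->
     (a, w) \in cycle_edges (x :: q)) -> chain S q.
Proof.
move=> /and3P[_ uq cy] sq xS H; split=> //.
- by move: uq => /= /andP[].
- by move: cy; rewrite /= rcons_path => /andP[pq _]; apply: path_sorted pq.
move=> s a b t qE w wS eaw.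
have uq' : uniq q by case/andP: uq.
have aq : a \in q by rewrite qE mem_cat inE eqxx orbT.
have xq : x \notin q by case/andP: uq.
have ia : index a q = size s.
  have := uq'; rewrite qE cat_uniq => /and3P[_ + _] /=; rewrite index_cat /=.
  rewrite eqxx addn0 => /norP[as_ _]; by rewrite (negbTE as_).
have al : a != last x q.
  apply/eqP=> E; have := uq'; rewrite qE cat_uniq /= => /and4P[_ _ + _].
  by rewrite E qE last_cat /= mem_last.
have xa : x != a by apply: contraNneq xq => ->.
have := H a aq al w wS eaw; rewrite in_cycle_edges.
(* [w] is either the successor of [a], hence [b], or its predecessor, which is not [x] and so lies
   in [s]. *)
case/orP=> /andP[_ /eqP E].
  left; rewrite E next_nth inE aq orbT /= (negbTE xa) ia qE.
  by rewrite nth_cat ltnNge leqnSn /= subSnn.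
have xw : x != w by apply: contraNneq xS => ->.
right; have wq : w \in q.
  case: (boolP (w \in q)) => // wq; move: E; rewrite next_nth inE eq_sym.
  by rewrite (negbTE xw) (negbTE wq) /= => E; rewrite -E aq in wq.
move: E; rewrite next_nth inE wq orbT /= (negbTE xw) => E.
case: (ltnP (index w q).+1 (size q)) => iw; last first.
  by rewrite nth_default // in E; rewrite E eqxx in xa.
have: index a q = (index w q).+1 by rewrite E index_uniq.
rewrite ia => sE.
case: (boolP (w \in s)) => // ws.
have : (size s <= index w q)%N by rewrite qE index_cat (negbTE ws) leq_addr.
by rewrite sE ltnn.
Qed.

(** The cycle is a connected component of the induced subgraph and has no chords. *)
Definition closed_cycle S c : Prop :=
  is_cycle (induced S) c /\
  forall x y, x \in c -> induced S x y -> (x, y) \in cycle_edges c.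

Lemma closed_cycle_rot k S c : closed_cycle S c -> closed_cycle S (rot k c).
Proof.
case=> cy H; split; first by rewrite is_cycle_rot.
have uc : uniq c by case/and3P: cy.
by move=> x y; rewrite mem_rot cycle_edges_rot //; apply: H.
Qed.

Lemma closed_cycle_chain S x q : closed_cycle S (x :: q) ->
  chain (S :\ x) q /\ forall w, w \in S :\ x -> e (last x q) w -> w \in q.
Proof.
case=> cy H; have [cye sub] := (proj1 (induced_cycle S _) cy).
have ux : uniq (x :: q) by case/and3P: cy.
split.
  apply: (cycle_chain cye).
  - move=> z zq; rewrite !inE sub ?inE ?zq ?orbT // andbT.
    by apply: contraTneq zq => ->; case/andP: ux.
  - by rewrite !inE eqxx.
  - move=> a aq _ w; rewrite in_setD1 => /andP[_ wS] eaw.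
    by apply: H; rewrite ?inE ?aq ?orbT //; apply/and3P; rewrite eaw wS sub // inE aq orbT.
move=> w; rewrite !inE => /andP[wx wS] elw.
have lc : last x q \in x :: q by rewrite mem_last.
have: (last x q, w) \in cycle_edges (x :: q).
  by apply: H => //; apply/and3P; rewrite elw wS sub.
by case/cycle_edges_mem/andP=> _; rewrite inE (negbTE wx).
Qed.

End Induced.

(** * Ranks of induced gain graphs *)

Section GainRank.
Variables (R : rcfType) (n : nat) (e : rel 'I_n).
Hypothesis se : simple_graph e.
Implicit Types (S T : {set 'I_n}) (c q : seq 'I_n) (phi : 'I_n -> 'I_n -> R[i]).

(** Stated without conjugation, this is stable under swapping the two arguments, so column arguments
    follow from row arguments by transposition. It also holds for the gain that is constantly 1. *)
Definition reciprocal phi : Prop := forall i j, e i j -> phi i j * phi j i = 1.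

Definition rk phi S : nat := \rank (gain_adj (induced e S) phi).

Lemma eq_rk phi S T : induced e S =2 induced e T -> rk phi S = rk phi T.
Proof.
by move=> E; congr (\rank _); apply/matrixP=> i j; rewrite !mxE E.
Qed.

Lemma gain_adj_del phi S y : gain_adj (induced e (S :\ y)) phi =
  keep _ y *m gain_adj (induced e S) phi *m keep _ y.
Proof.
apply/matrixP=> i j; rewrite keep_entry !mxE /induced !inE.
by case: (i == y); case: (j == y); rewrite /= ?andbF.
Qed.

Lemma rk_del_le phi S y : (rk phi (S :\ y) <= rk phi S)%N.
Proof. by rewrite /rk gain_adj_del rank_keep_le. Qed.

Lemma rk_le_del phi S y : (rk phi S <= rk phi (S :\ y) + 2)%N.
Proof. by rewrite /rk gain_adj_del rank_le_keep. Qed.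

Lemma gain_adjT phi S :
  (gain_adj (induced e S) phi)^T = gain_adj (induced e S) (fun i j => phi j i).
Proof. by apply/matrixP=> i j; rewrite !mxE (proj2 (induced_simple se S)). Qed.

Lemma reciprocalT phi : reciprocal phi -> reciprocal (fun i j => phi j i).
Proof. by move=> H i j; rewrite (proj2 se) => /H. Qed.

(** Row [u] and column [u] have a single nonzero entry, at [v]. Scaled, they are unit vectors at
    [v], so deleting [v] lowers the rank by exactly 2. *)
Lemma rk_pendant phi S u v : reciprocal phi -> pendant_in e S u -> v \in S -> e u v ->
  rk phi S = (rk phi (S :\ u :\ v) + 2)%N.
Proof.
move=> rphi pu vS euv; have N := pendant_uniq pu vS euv.
have uS : u \in S by case/andP: pu.
have uv : u != v by apply: contraTneq euv => ->; rewrite (proj1 se).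
rewrite (eq_rk _ (induced_pendant se pu vS euv)).
have rowu (psi : 'I_n -> 'I_n -> R[i]) : reciprocal psi ->
    ((psi u v)^-1 *: delta_mx 0 u) *m gain_adj (induced e S) psi = delta_mx (0 : 'I_1) v.
  move=> rpsi; rewrite -scalemxAl -rowE; apply/rowP=> j; rewrite !mxE /induced uS /=.
  case: (altP (j =P v)) => [->|jv].
    rewrite euv vS /= mulVf //; apply/eqP=> E; have := rpsi _ _ euv.
    by rewrite E mul0r => /eqP; rewrite eq_sym oner_eq0.
  case: ifP => [/andP[euj jS]|_]; last by rewrite mulr0.
  by rewrite (N j) // eqxx in jv.
rewrite /rk (gain_adj_del _ _ v).
apply: (rank_keepD2 (rowu _ rphi) (ze := ((phi v u)^-1 *: delta_mx 0 u)^T)).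
  apply: trmx_inj; rewrite trmx_mul trmxK gain_adjT trmx_delta.
  exact: (rowu (fun i j => phi j i) (reciprocalT rphi)).
by rewrite !mxE eq_sym (negbTE uv) andbF mulr0.
Qed.

(** Each step removes two vertices and lowers the rank by 2; the sums avoid subtraction of natural
    numbers. *)
Lemma rk_delta_star phi S T : reciprocal phi -> delta_star e S T ->
  (rk phi S + #|T| = rk phi T + #|S|)%N.
Proof.
move=> rphi; elim=> // {S T} S S' T [u [v [pu vS euv ->]]] _ IH.
have uS : u \in S by case/andP: pu.
have uv : u != v by apply: contraTneq euv => ->; rewrite (proj1 se).
rewrite (rk_pendant rphi pu vS euv) (cardsD1 u S) (cardsD1 v (S :\ u)) uS !inE eq_sym uv vS /=.
move: IH; rewrite /= ; lia.
Qed.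

Lemma rk_chain phi S q x : reciprocal phi -> chain e S q ->
  (forall w, w \in S -> e (last x q) w -> w \in q) ->
  rk phi S = (rk phi (S :\: [set x in q]) + (size q)./2.*2)%N.
Proof.
move=> rphi cq lq; have [T [dT iT cT]] := chain_closed_delta_star se cq lq.
have := rk_delta_star rphi dT; rewrite -(eq_rk _ iT) cT.
by rewrite [(#|T| + _)%N]addnC addnA => /addIn.
Qed.

(** Opened at [x], the cycle is a path on [(size c).-1] vertices, whose rank is the largest even
    number not above that. *)
Lemma rk_closed_cycle_del phi S c x : reciprocal phi -> closed_cycle e S c -> x \in c ->
  rk phi (S :\ x) = (rk phi (S :\: [set y in c]) + (size c).-1./2.*2)%N.
Proof.
move=> rphi cc xc; have [k q rE] := rot_to xc.
have := closed_cycle_rot k cc; rewrite rE => cc'.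
have [cq lq] := closed_cycle_chain cc'.
rewrite (rk_chain rphi cq lq) -(size_rot k c) rE /=; congr (rk _ _ + _)%N.
apply/setP=> y; rewrite !inE -(mem_rot k c) rE inE negb_or.
by case: (y == x) => //=; rewrite andbF.
Qed.

(** The matrix is the one without the cycle plus a summand of rank at most 1 for each row indexed by
    [c]. *)
Lemma rk_closed_cycle_le phi S c : closed_cycle e S c ->
  (rk phi S <= rk phi (S :\: [set y in c]) + size c)%N.
Proof.
case=> cy H; have uc : uniq c by case/and3P: cy.
set M := gain_adj (induced e S) phi.
have E : M = gain_adj (induced e (S :\: [set y in c])) phi
             + \sum_(x <- c) delta_mx x x *m M.
  apply/matrixP=> i j; rewrite [RHS]mxE summxE.
  have dE x : (delta_mx x x *m M) i j = if i == x then M x j else 0.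
    rewrite mxE (bigD1 x) //= mxE eqxx andbT big1 ?addr0.
      by case: (i == x); rewrite ?mul1r ?mul0r.
    by move=> k kx; rewrite mxE (negbTE kx) andbF mul0r.
  under eq_bigr do rewrite dE.
  case: (boolP (i \in c)) => ic.
    rewrite (bigD1_seq i) //= eqxx big1 ?addr0; last first.
      by move=> k; rewrite eq_sym => /negbTE ->.
    by rewrite !mxE /induced !inE ic /= andbF /= add0r.
  rewrite big1_seq ?addr0 => [|k /andP[_ kc]]; last first.
    by case: eqP => // E; rewrite E kc in ic.
  rewrite !mxE /induced !inE ic /=.
  case: (boolP (j \in c)) => jc //=; rewrite !andbF.
  case: ifP => // ij; move: ic; suff -> : i \in c by [].
  have : induced e S j i by rewrite (proj2 (induced_simple se S)).
  by move=> /(H _ _ jc)/cycle_edges_mem/andP[].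
rewrite /rk -/M E; apply: leq_trans (mxrank_add _ _) _; rewrite leq_add2l.
elim: (c) => [|x c' IH]; first by rewrite big_nil mxrank0.
rewrite big_cons; apply: leq_trans (mxrank_add _ _) _; rewrite /= -add1n leq_add //.
by apply: leq_trans (mxrankM_maxl _ _) _; rewrite mxrank_delta.
Qed.

End GainRank.

Lemma half_pred_double m : ~~ odd m -> (m.-1./2.*2 = m - 2)%N.
Proof. by case: m => [|k] //=; rewrite negbK; lia. Qed.

Lemma odd_half_pred_double m : odd m -> (m.-1./2.*2 = m.-1)%N.
Proof. by case: m => // k /= ok; rewrite even_halfK. Qed.

(** * The rank of an even cycle that is a component *)

Section CycleRank.
Variables (R : rcfType) (n : nat) (e : rel 'I_n).
Hypothesis se : simple_graph e.
Implicit Types (S T : {set 'I_n}) (c q : seq 'I_n) (phi : 'I_n -> 'I_n -> R[i]).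

(* The rows of the odd-indexed vertices of the cycle, weighted by alternating
   signs and by the gain of the initial segment, telescope around the cycle. *)
Lemma cycle_vector phi S x0 x1 q (c := [:: x0, x1 & q]) :
  reciprocal e phi -> closed_cycle e S c -> ~~ odd (size c) ->
  exists xi : 'rV[R[i]]_n,
  [/\ xi *m gain_adj (induced e S) phi =
        (1 - (-1) ^+ (size c)./2 * cycle_gain phi c) *: delta_mx 0 x0,
      xi 0 x0 = 0 & xi 0 x1 != 0].
Proof.
move=> rphi [cy H] ec; have [cye sub] := (proj1 (induced_cycle e S _) cy).
have /and3P[s2 uc cyc] := cye.
(* Indices are read modulo [p], so [v p] is [x0] again and the successor of [v i] is always
   [v i.+1]. *)
set M := gain_adj _ _; set p := size c; pose v i := nth x0 c (i %% p).
have p0 : (0 < p)%N by [].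
have vc i : v i \in c by rewrite mem_nth // ltn_pmod.
have vn i : next c (v i) = v i.+1.
  rewrite next_nth vc {2}/c {1}/v index_uniq // ?ltn_pmod // /v.
  have -> : (i.+1 %% p = (i %% p).+1 %% p)%N by rewrite -addn1 -[in RHS]addn1 modnDml.
  case: (ltnP (i %% p).+1 p) => ip.
    by rewrite (modn_small ip).
  rewrite [LHS]nth_default //; have -> : (i %% p).+1 = p; last by rewrite modnn.
  by apply/eqP; rewrite eqn_leq ip ltn_pmod.
have vinj i j : v i = v j -> i = j %[mod p].
  by move/eqP; rewrite nth_uniq ?ltn_pmod // => /eqP.
have ev i : e (v i) (v i.+1) by rewrite -vn; apply: next_cycle.
pose d i : 'rV[R[i]]_n := delta_mx 0 (v i).
have rowv i : d i.+1 *m M = phi (v i.+1) (v i) *: d i + phi (v i.+1) (v i.+2) *: d i.+2.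
  rewrite -rowE; apply/rowP=> k; rewrite !mxE /=.
  (* Since [p] exceeds 2, the two neighbours of [v i.+1] on the cycle are distinct. *)
  have ne : v i != v i.+2.
    apply/eqP=> /vinj E; have: (i + 0 = i + 2 %[mod p])%N by rewrite addn0 addn2.
    by move/eqP; rewrite eqn_modDl mod0n modn_small.
  case: (altP (k =P v i)) => [->|ki].
    rewrite (negbTE ne) mulr0 addr0 mulr1.
    by rewrite /induced (proj2 se) ev !sub.
  case: (altP (k =P v i.+2)) => [->|k2].
    by rewrite /induced ev !sub //= mulr0 add0r mulr1.
  rewrite !mulr0 addr0; case: ifP => // /(H _ _ (vc _)); rewrite in_cycle_edges vn.
  case/orP=> /andP[_ /eqP E]; first by rewrite E eqxx in k2.
  case/eqP: ki; apply: (can_inj (prev_next uc)).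
  by rewrite -E vn.
pose g i := \prod_(j < i) phi (v j) (v j.+1).
have gS i : g i.+1 = g i * phi (v i) (v i.+1) by rewrite /g big_ord_recr.
have g1 i : g i.+1 * phi (v i.+1) (v i) = g i.
  by rewrite gS -mulrA rphi ?mulr1.
have gn0 i : g i != 0.
  apply/prodf_neq0=> j _; apply/eqP=> E; have := rphi _ _ (ev j).
  by rewrite E mul0r => /eqP; rewrite eq_sym oner_eq0.
have gp : g p = cycle_gain phi c.
  rewrite /cycle_gain (big_nth x0) big_mkord; apply: eq_bigr => j _.
  by rewrite -vn {1 2}/v modn_small // /v modn_small.
(* The matrix maps the summand with index [m] below to [f m - f m.+1]; the end terms [f 0] and
   [f p./2] both sit at [x0]. *)
pose f m := ((-1) ^+ m * g m.*2) *: d m.*2.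
have pE : (p./2.*2 = p)%N by rewrite even_halfK.
exists (\sum_(m < p./2) ((-1) ^+ m * g m.*2.+1) *: d m.*2.+1); split.
- rewrite mulmx_suml (eq_bigr (fun m : 'I__ => - (f m.+1 - f m))) => [|m _]; last first.
    rewrite -scalemxAl rowv /f scalerDr !scalerA -!mulrA g1 doubleS -gS exprS.
    by rewrite mulN1r mulNr scaleNr opprB opprK.
  rewrite sumrN -(big_mkord xpredT (fun m => f m.+1 - f m)) telescope_sumr // opprB.
  rewrite /f pE gp /d {1}/v {1}/v double0 modnn mod0n /= /g big_ord0 mulr1.
  by rewrite -scalerBl.
- rewrite summxE big1 // => m _; rewrite !mxE /=.
  case: (altP (x0 =P v _)) => [E|]; last by rewrite mulr0.
  have : (m.*2.+1 < p)%N by rewrite -[X in (_ < X)%N]pE ltn_Sdouble.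
  move=> mp; have := @vinj 0%N m.*2.+1 E.
  by rewrite mod0n modn_small.
have x1E : x1 = v 1 by rewrite /v modn_small.
have hp : (0 < p./2)%N by rewrite half_gt0 ltnW.
rewrite summxE (bigD1 (Ordinal hp)) //= big1 ?addr0 => [|m mN].
  rewrite !mxE x1E !eqxx mulr1 mul1r double0; exact: gn0.
rewrite !mxE x1E /=; case: (altP (v 1 =P v _)) => [E|]; last by rewrite mulr0.
have : (m.*2.+1 < p)%N by rewrite -[X in (_ < X)%N]pE ltn_Sdouble.
move=> mp; have := vinj _ _ E; rewrite !modn_small // => -[] /eqP.
by rewrite eq_sym double_eq0 => /eqP m0; case/eqP: mN; apply: val_inj.
Qed.

Lemma cycle_gainT phi c : reciprocal e phi -> is_cycle e c ->
  cycle_gain phi c * cycle_gain (fun i j => phi j i) c = 1.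
Proof.
move=> rphi /and3P[_ _ cy]; rewrite /cycle_gain -big_split big_seq big1 //= => x xc.
by rewrite rphi // next_cycle.
Qed.

(** For Type A, [cycle_vector] gives kernel vectors that do not vanish at [x1], and deleting [x1]
    keeps the rank. Otherwise it gives, after scaling, the unit vector at [x0], and deleting [x0]
    lowers the rank by 2. Either way an open path is left. *)
Lemma rk_closed_cycle phi S c : reciprocal e phi -> closed_cycle e S c ->
  ~~ odd (size c) ->
  rk e phi S = (rk e phi (S :\: [set y in c]) + size c - (typeA phi c).*2)%N.
Proof.
move=> rphi cc ec; have rpT := reciprocalT se rphi.
have [cye _] := (proj1 (induced_cycle e S c) (proj1 cc)).
have del x := @rk_closed_cycle_del _ _ _ se phi S c x rphi cc.
have cs := half_pred_double ec.
have c2 : (2 < size c)%N by case/and3P: cye.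
have gT := cycle_gainT rphi cye.
case: c cc ec cye del cs c2 gT => [|x0 [|x1 q]] // cc ec cye del cs c2 gT.
set c := [:: x0, x1 & q] in cc ec cye del cs c2 gT *.
have x0c : x0 \in c by rewrite inE eqxx.
have x1c : x1 \in c by rewrite !inE eqxx orbT.
have [xi [xM x00 x1n]] := cycle_vector rphi cc ec.
have [ze [zM z00 z1n]] := cycle_vector rpT cc ec.
move: xM zM; rewrite -/c; set G := cycle_gain phi c in gT *.
set G' := cycle_gain _ c in gT *; set s := (-1) ^+ _ => xM zM.
have ss : s * s = 1 by rewrite -expr2 sqrr_sign.
have MT : gain_adj (induced e S) phi *m ze^T =
   ((ze *m gain_adj (induced e S) (fun i j => phi j i)))^T.
  by rewrite trmx_mul gain_adjT.
have tA : typeA phi c = (G == s) by rewrite /typeA ec.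
rewrite tA; case: (altP (G =P s)) => [E|NE] /=.
  (* The transposed matrix has the inverse gain [G'], and the sign [s] is its own inverse. *)
  have E' : G' = s by rewrite -[LHS]mul1r -ss -{2}E -mulrA gT mulr1.
  rewrite -[RHS]addnBA; last by rewrite ltnW.
  rewrite -[(1.*2)%N]/2%N -cs -(del x1) // /rk gain_adj_del.
  apply: (rank_eq_keep (xi := xi) (ze := ze^T)) => //.
  - by rewrite xM E ss subrr scale0r.
  - by rewrite MT zM E' ss subrr scale0r trmx0.
  - by rewrite mxE.
have k1 : 1 - s * G != 0.
  rewrite subr_eq0; apply: contraNneq NE => E.
  by rewrite -[G]mul1r -ss -mulrA -E mulr1.
have k2 : 1 - s * G' != 0.
  rewrite subr_eq0; apply: contraNneq NE => E.
  have : G * (s * G') = G by rewrite -E mulr1.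
  by rewrite mulrCA gT mulr1 => ->.
have -> : (rk e phi (S :\: [set y in c]) + size c - 0.*2 =
           rk e phi (S :\ x0) + 2)%N by rewrite (del x0) // cs subn0 -addnA subnK // ltnW.
rewrite /rk gain_adj_del.
apply: (rank_keepD2 (xi := (1 - s * G)^-1 *: xi) (ze := ((1 - s * G')^-1 *: ze)^T)).
- by rewrite -scalemxAl xM scalerA mulVf // scale1r.
- apply: trmx_inj; rewrite trmx_mul trmxK gain_adjT // trmx_delta.
  by rewrite -scalemxAl zM scalerA mulVf // scale1r.
- by rewrite !mxE z00 mulr0.
Qed.

End CycleRank.

(** * Bridges *)

Section Bridges.
Variables (n : nat) (e : rel 'I_n).
Hypothesis se : simple_graph e.
Implicit Types (S T D : {set 'I_n}) (c q : seq 'I_n).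

(** Vertices outside [S] remain as isolated ones; each adds one vertex and one component, so the
    value is that of the subgraph on [S]. *)
Definition induced_theta S : int := theta (induced e S).
Local Notation th := induced_theta.

Lemma eq_induced_theta S T : induced e S =2 induced e T -> th S = th T.
Proof. exact: eq_theta. Qed.

Lemma is_cycle_edges_sub (e1 e2 : rel 'I_n) c : is_cycle e1 c ->
  (forall x y, (x, y) \in cycle_edges c -> e2 x y) -> is_cycle e2 c.
Proof.
case/and3P=> s u _ H; apply/and3P; split=> //; apply: cycle_from_next => // x xc.
by apply: H; rewrite in_cycle_edges xc eqxx.
Qed.

(** An edge with an end outside [T] lies on no cycle, so its deletion leaves [theta] unchanged. *)
Lemma induced_theta_sub S T : T \subset S ->
  (forall c, is_cycle (induced e S) c -> {subset c <= T}) -> th T = th S.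
Proof.
move=> /subsetP TS H.
have [|_] := theta_sub (induced_simple se T) (induced_simple se S).
  by move=> x y /and3P[exy xT yT]; apply/and3P; rewrite exy !TS.
apply.
move=> x y c cy cxy; have /andP[xc yc] := cycle_edges_mem cxy.
have /and3P[exy _ _] := is_cycle_edge (proj2 (induced_simple se S)) cy cxy.
by apply/and3P; rewrite exy !(H c cy).
Qed.

Lemma induced_del_sub S x : subrel (induced e (S :\ x)) (induced e S).
Proof. by move=> a b /and3P[eab]; rewrite !inE => /andP[_ aS] /andP[_ bS]; apply/and3P. Qed.

Lemma induced_del S x y : ~~ induced e (S :\ x) x y.
Proof. by rewrite /induced !inE eqxx /= andbF. Qed.

Lemma induced_del_sub_del_edge S x y :
  subrel (induced e (S :\ x)) (del_edge (induced e S) x y).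
Proof.
apply: subrel_del_edge; [by case: (induced_simple se (S :\ x)) | |].
  exact: induced_del_sub.
exact: induced_del.
Qed.

Lemma induced_theta_del_cycle S c x : is_cycle (induced e S) c -> x \in c -> th (S :\ x) + 1 <= th S.
Proof.
move=> cy xc; apply: (theta_del_cycle (c := c) (a := x) (b := next c x)) => //.
- exact: induced_simple.
- exact: induced_simple.
- exact: induced_del_sub.
- by rewrite in_cycle_edges xc eqxx.
- exact: induced_del.
Qed.

(** Deleting the edge from [x] to [y] breaks [c1] but not [c2]; deleting the other edges at [x] then
    breaks [c2]. *)
Lemma induced_theta_del_cycle2 S c1 c2 x y : is_cycle (induced e S) c1 -> is_cycle (induced e S) c2 ->
  x \in c2 -> (x, y) \in cycle_edges c1 -> (x, y) \notin cycle_edges c2 ->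
  th (S :\ x) + 2 <= th S.
Proof.
move=> cy1 cy2 x2 xy1 xy2.
have sS := induced_simple se S.
have exy := is_cycle_edge (proj2 sS) cy1 xy1.
rewrite {2}/induced_theta (theta_del_edge sS exy) (cycle_del_edge_connect sS cy1 xy1) /=.
suff: th (S :\ x) + 1 <= theta (del_edge (induced e S) x y) by lia.
have sd := del_edge_simple x y sS.
have nxy : (y, x) \notin cycle_edges c2 by rewrite cycle_edgesC.
apply: (theta_del_cycle (c := c2) (a := x) (b := next c2 x)) => //.
- exact: induced_simple.
- exact: induced_del_sub_del_edge.
- apply: (is_cycle_edges_sub cy2) => a b ab.
  rewrite /= (is_cycle_edge (proj2 sS) cy2 ab) /=; apply/andP; split; apply/eqP=> E.
    by rewrite E (negbTE xy2) in ab.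
  by rewrite E (negbTE nxy) in ab.
- by rewrite in_cycle_edges x2 eqxx.
- exact: induced_del.
Qed.

Definition bridge S (z x : 'I_n) : bool :=
  induced e S z x && ~~ connect (del_edge (induced e S) z x) z x.

Lemma bridge_off_cycle S z x c : bridge S z x -> is_cycle (induced e S) c ->
  (z, x) \notin cycle_edges c.
Proof.
case/andP=> _ N cy; apply: contra N; apply: cycle_del_edge_connect => //.
exact: induced_simple.
Qed.

Lemma nonbridge_cycle S z x : induced e S z x -> ~~ bridge S z x ->
  exists2 c, is_cycle (induced e S) c & (z, x) \in cycle_edges c.
Proof.
move=> zx; rewrite /bridge zx /= negbK.
apply: del_edge_connect_cycle => //; exact: induced_simple.
Qed.

(** Cycles are sequences of arbitrary length, so the cases are separated by a finite search for an
    edge that is not a bridge. *)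
Lemma cyclic_or_acyclic S : (exists c, is_cycle (induced e S) c) \/
  (forall c, ~~ is_cycle (induced e S) c).
Proof.
case: (pickP (fun p : 'I_n * 'I_n => induced e S p.1 p.2 && ~~ bridge S p.1 p.2)).
  by case=> a b /andP[/= ab /(nonbridge_cycle ab)[c cy _]]; left; exists c.
move=> no; right=> -[|x c] //; apply/negP=> cy.
have xy : (x, next (x :: c) x) \in cycle_edges (x :: c).
  by rewrite in_cycle_edges inE !eqxx.
have := no (x, next (x :: c) x).
rewrite /= (is_cycle_edge (proj2 (induced_simple se S)) cy xy) /= => /negbFE b.
by have := bridge_off_cycle b cy; rewrite xy.
Qed.

Lemma bridgeC S z x : bridge S z x = bridge S x z.
Proof.
have sS := induced_simple se S.
rewrite /bridge (proj2 sS) (eq_connect (del_edgeC _ _ _)).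
by rewrite (sym_connect_sym (proj2 (del_edge_simple x z sS))).
Qed.

(* [D] is the side of [x] of a bridge [zx], chosen of minimal size: a bridge
   inside [D] would cut off a smaller side. *)
Lemma minimal_bridge_side S : (exists z x, bridge S z x) ->
  exists z x D, [/\ bridge S z x, x \in D &
    forall a b, a \in D -> induced e S a b -> (a, b) = (x, z) \/
      b \in D /\ exists2 c, is_cycle (induced e S) c & (a, b) \in cycle_edges c].
Proof.
case=> z0 [x0 b0].
(* The end [p.1] is deleted as a vertex; for a bridge, deleting just the edge would leave the same
   component of [p.2]. *)
pose side (p : 'I_n * 'I_n) := [set w | connect (induced e (S :\ p.1)) p.2 w].
pose B (p : 'I_n * 'I_n) := bridge S p.1 p.2.
case: (@arg_minnP _ (z0, x0) B (fun p => #|side p|) b0) => -[z x] /= bzx minzx.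
rewrite /B /= in bzx.
have sS := induced_simple se S.
have [zxS Nzx] := andP bzx.
have [ezx zS xS] := and3P zxS.
have zx : z != x by apply: contraTneq ezx => <-; rewrite (proj1 se).
have con_del u v a b : connect (induced e (S :\ u)) a b ->
    connect (del_edge (induced e S) u v) a b.
  by apply: connect_sub => s t /induced_del_sub_del_edge st; apply: connect1; apply: st.
have symd u v := sym_connect_sym (proj2 (del_edge_simple u v sS)).
have side_neq u v a : v != u -> a \in side (u, v) -> a != u.
  move=> vu; rewrite inE => /connectP[p pp ->]; case/lastP: p pp => [|p w] //=.
  rewrite rcons_path last_rcons => /andP[_ /and3P[_ _]].
  by rewrite !inE => /andP[].
have F2 a : a \in side (z, x) -> induced e S a z -> a = x.
  move=> aD az; apply/eqP; apply: contraNT Nzx => ax.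
  have azd : del_edge (induced e S) z x z a.
    rewrite /= (proj2 sS) az !xpair_eqE (negbTE ax) andbF /=.
    by rewrite (negbTE zx).
  apply: connect_trans (connect1 azd) _; rewrite symd.
  by apply: con_del; move: aD; rewrite inE.
have F1 a b : a \in side (z, x) -> induced e S a b -> b != z -> b \in side (z, x).
  move=> aD /and3P[eab aS bS] bz.
  have xz : x != z by rewrite eq_sym.
  have az := side_neq _ _ _ xz aD.
  move: aD; rewrite !inE => /connect_trans -> //; apply: connect1.
  by apply/and3P; rewrite !inE az bz.
exists z, x, (side (z, x)); split=> //; first by rewrite inE connect0.
move=> a b aD ab.
case: (altP (b =P z)) => [bz|bz]; first by left; rewrite bz (F2 a) // -bz.
right; have bD := F1 _ _ aD ab bz; split=> //.
apply: nonbridge_cycle => //; apply/negP=> bab.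
(* If [x] were not beyond the bridge, [side (u, v)] would stay within [side (z, x)], whose only exit
   is through [x], and it would miss [u], against minimality. *)
have inside u v : bridge S u v -> u \in side (z, x) -> v \in side (z, x) ->
    x \in side (u, v).
  move=> buv uD vD; apply: contraT => xN.
  have vu : v != u.
    by case/andP: buv => /and3P[euv _ _] _; apply: contraTneq euv => ->; rewrite (proj1 se).
  suff: side (u, v) \proper side (z, x).
    by move=> /proper_card; rewrite ltnNge minzx.
  apply/properP; split; last first.
    by exists u => //; apply/negP=> /(side_neq _ _ _ vu); rewrite eqxx.
  apply/subsetP=> w; rewrite inE => /connectP[p pp ->] {w}.
  have : v \in side (u, v) by rewrite inE connect0.
  suff K s : s \in side (z, x) -> path (induced e (S :\ u)) s p ->
      s \in side (u, v) -> last s p \in side (z, x) by apply: K.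
  elim: p s {pp} => [|t p IHp] s sD //= + sN.
  case/andP=> st pp.
  have tN : t \in side (u, v).
    by move: sN; rewrite !inE => /connect_trans; apply; apply: connect1.
  apply: (IHp t) => //; apply: (F1 s) => //; first exact: induced_del_sub st.
  apply/eqP=> tz; move: xN; rewrite -(F2 s) ?sN // -tz; exact: induced_del_sub st.
(* [x] is reached from [b] without [a] and from [a] without [b], so [a] and [b] are connected
   without their edge. *)
have xab := inside _ _ bab aD bD.
have xba : x \in side (b, a) by apply: inside => //; rewrite bridgeC.
case/andP: bab => _ /negP; apply.
apply: (connect_trans (y := x)).
  by rewrite (eq_connect (del_edgeC _ _ _)); apply: con_del; move: xba; rewrite inE.
by rewrite symd; apply: con_del; move: xab; rewrite inE.
Qed.

(** In a forest every edge is a bridge. Within a minimal side every edge lies on a cycle, so here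
    there is none, and the end [x] is pendant. *)
Lemma acyclic_pendant S a b : (forall c, ~~ is_cycle (induced e S) c) ->
  induced e S a b -> exists u, pendant_in e S u.
Proof.
move=> ac ab.
have : bridge S a b.
  apply: contraT => nb; have [c cy _] := nonbridge_cycle ab nb.
  by rewrite (negbTE (ac c)) in cy.
move=> bab; have [|z [x [D [bzx xD H]]]] := @minimal_bridge_side S; first by exists a, b.
have /andP[/and3P[ezx zS xS] _] := bzx.
exists x; apply: (pendantI (v := z)) => //; first by rewrite (proj2 se).
move=> w wS exw; case: (H x w xD); first exact/and3P.
  by case.
by case=> _ [c cy _]; rewrite (negbTE (ac c)) in cy.
Qed.

Lemma next2_neq (e' : rel 'I_n) c x : is_cycle e' c -> x \in c -> next c (next c x) != x.
Proof.
case/and3P=> sc uc _ xc; have [k q rE] := rot_to xc.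
rewrite -!(next_rot k uc) rE; have : uniq (x :: q) by rewrite -rE rot_uniq.
have : (2 < size (x :: q))%N by rewrite -rE size_rot.
case: q {rE} => [|y [|t q]] //= _; rewrite !inE !negb_or eqxx => /and3P[/and3P[xy xt _] _ _].
by rewrite (eq_sym y x) (negbTE xy) eqxx eq_sym.
Qed.

Lemma pendant_off_cycle S u c : pendant_in e S u -> is_cycle (induced e S) c -> u \notin c.
Proof.
move=> pu cy; apply/negP=> uc; have uniqc : uniq c by case/and3P: cy.
have /and3P[_ _ cyc] := cy.
have /and3P[e1 _ nS] := next_cycle cyc uc.
have /and3P[e2 pS _] := prev_cycle cyc uc.
have := pendant_uniq pu nS e1 pS; rewrite (proj2 se) => /(_ e2) E.
have /eqP := next2_neq cy uc; apply.
by rewrite -E next_prev.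
Qed.

Lemma pendant_ext S T u : T \subset S -> (forall w, w \in S -> e u w -> w \in T) ->
  pendant_in e T u -> pendant_in e S u.
Proof.
move=> /subsetP TS H pu; have [v [uT vT euv]] := pendantE pu.
apply: (pendantI (v := v)) => //; try exact: TS.
by move=> w wS euw; apply: (pendant_uniq pu) => //; apply: H.
Qed.

Lemma not_pendantE S u v : no_pendant e S -> u \in S -> v \in S -> e u v ->
  exists w, [/\ w \in S, e u w & w != v].
Proof.
move=> np uS vS euv.
case: (pickP [pred w | [&& w \in S, e u w & w != v]]) => [w /and3P[]|no]; first by exists w.
have /negP[] := np u; apply: (pendantI uS vS euv) => w wS euw.
by apply/eqP; have := no w; rewrite /= wS euw /= => /negbFE.
Qed.

Lemma no_pendant_delta_star S T : no_pendant e S -> delta_star e S T -> T = S.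
Proof. by move=> np dT; case: dT np => // S1 S2 S3 [u [v [pu _ _ _]]] _ /(_ u); rewrite pu. Qed.

End Bridges.

(** * Tight graphs *)

(* [lia] does not identify convertible instances of ranks and thetas, so abstract them first. *)
Ltac rk_lia :=
  repeat match goal with
  | H : context [rk _ _ _] |- _ => move: H
  | H : context [induced_theta _ _] |- _ => move: H
  end;
  repeat match goal with
  | |- context [rk ?e ?p ?S] => move: (rk e p S) => ?
  | |- context [induced_theta ?e ?S] => move: (induced_theta e S) => ?
  end; lia.

Section Tight.
Variables (R : rcfType) (n : nat) (e : rel 'I_n).
Hypothesis se : simple_graph e.

(** The 0-1 adjacency matrix is treated as the matrix of this gain, so that each rank lemma serves
    both ranks. *)
Definition trivial_gain (i j : 'I_n) : R[i] := 1.

Variable phi : 'I_n -> 'I_n -> R[i].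
Hypothesis rphi : reciprocal e phi.
Implicit Types (S T D : {set 'I_n}) (c q : seq 'I_n).

Local Notation psi := trivial_gain.
Local Notation th := (induced_theta e).

Lemma reciprocal1 : reciprocal e psi.
Proof. by move=> i j _; rewrite /trivial_gain mulr1. Qed.

Local Notation rpsi := reciprocal1.

(* A [Variant] rather than a [Definition]: unfolding it makes conversion tests
   compare ranks by computation. *)
Variant tight S : Prop :=
  Tight of (rk e phi S)%:Z = (rk e psi S)%:Z - 2 * th S.

Lemma tightP S : tight S <-> (rk e phi S)%:Z = (rk e psi S)%:Z - 2 * th S.
Proof. by split=> [[]|]. Qed.

Lemma eq_tight S T : induced e S =2 induced e T -> tight S -> tight T.
Proof.
move=> E /tightP tS; apply/tightP; move: tS.
by rewrite (eq_rk phi E) (eq_rk psi E) (eq_induced_theta E).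
Qed.

Lemma acyclic_th S : (forall c, ~~ is_cycle (induced e S) c) -> th S = 0.
Proof.
move=> ac; rewrite -(@induced_theta_sub _ _ se S set0) ?sub0set //; last first.
  by move=> c cy; rewrite (negbTE (ac c)) in cy.
by apply: theta_no_edge => x y; rewrite /induced !inE !andbF.
Qed.

Lemma acyclic_rk S : (forall c, ~~ is_cycle (induced e S) c) -> rk e phi S = rk e psi S.
Proof.
move mE: #|S| => m; elim/ltn_ind: m S mE => m IHm S mE ac.
case: (pickP (fun p : 'I_n * 'I_n => induced e S p.1 p.2)) => [[a b] /= ab|no]; last first.
  by congr (\rank _); apply/matrixP=> i j; rewrite !mxE; have := no (i, j) => /= ->.
have [u pu] := acyclic_pendant se ac ab.
have [v [uS vS euv]] := pendantE pu.
rewrite (rk_pendant se rphi pu vS euv) (rk_pendant se rpsi pu vS euv); congr (_ + _)%N.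
have sub : S :\ u :\ v \subset S by apply/subsetP=> w; rewrite !inE => /and3P[].
apply: (IHm #|S :\ u :\ v|) => //.
  rewrite -mE; apply: proper_card; apply/properP.
  by split=> //; exists u; rewrite // !inE eqxx /= andbF.
by move=> c; apply: contra (ac c); apply: induced_cycle_sub.
Qed.

Lemma acyclic_tight S : (forall c, ~~ is_cycle (induced e S) c) -> tight S.
Proof. by move=> ac; apply/tightP; rewrite acyclic_th // mulr0 subr0 acyclic_rk. Qed.

Lemma setD1_card_lt S x : x \in S -> (#|S :\ x| < #|S|)%N.
Proof. by move=> xS; rewrite (cardsD1 x S) xS. Qed.

Lemma cycle_in S c x : is_cycle (induced e S) c -> x \in c -> x \in S.
Proof. by case/induced_cycle=> _; apply. Qed.

(** Deleting a cycle vertex does not lower the left side and does not raise the right side; forests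
    give equality. *)
Lemma rk_lower_bound S : (rk e psi S)%:Z - 2 * th S <= (rk e phi S)%:Z.
Proof.
move mE: #|S| => m; elim/ltn_ind: m S mE => m IHm S mE.
case: (cyclic_or_acyclic se S) => [[[|x c] cy] // | /acyclic_tight/tightP tS]; last first.
  by rewrite -tS.
have xc : x \in x :: c by rewrite inE eqxx.
have := IHm _ _ (S :\ x) erefl; rewrite -mE (setD1_card_lt (cycle_in cy xc)) => /(_ isT).
have := induced_theta_del_cycle se cy xc.
have := rk_del_le e phi S x; have := rk_le_del e psi S x.
rk_lia.
Qed.

(** Equality must hold throughout the estimates behind [rk_lower_bound]. *)
Lemma tight_del_cycle S c x : tight S -> is_cycle (induced e S) c -> x \in c ->
  [/\ tight (S :\ x), rk e phi (S :\ x) = rk e phi S,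
      rk e psi S = (rk e psi (S :\ x) + 2)%N & th S = th (S :\ x) + 1].
Proof.
move=> /tightP tS cy xc.
have := induced_theta_del_cycle se cy xc; have := rk_lower_bound (S :\ x).
have := rk_del_le e phi S x; have := rk_le_del e psi S x.
by move=> h1 h2 h3 h4; split; try apply/tightP; rk_lia.
Qed.

(** Deleting a vertex where two cycles diverge would lower [theta] by at least 2, but tightness
    allows exactly 1. *)
Lemma tight_cycles_disjoint S c1 c2 : tight S ->
  is_cycle (induced e S) c1 -> is_cycle (induced e S) c2 ->
  cycle_edges c1 <> cycle_edges c2 -> [disjoint c1 & c2].
Proof.
move=> tS cy1 cy2 ne; apply: contraT => nd.
have u1 : uniq c1 by case/and3P: cy1.
have u2 : uniq c2 by case/and3P: cy2.
have [x [y [x1 x2 xy]]] := cycles_diverge u1 u2 ne nd.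
have [_ _ _ E] := tight_del_cycle tS cy1 x1.
suff : th (S :\ x) + 2 <= th S by rewrite E; rk_lia.
case: (boolP ((x, y) \in cycle_edges c1)) xy => h1 /= h2.
  exact: (induced_theta_del_cycle2 se cy1 cy2 x2 h1 h2).
exact: (induced_theta_del_cycle2 se cy2 cy1 x1 h2 h1).
Qed.

Lemma tight_cycle_edge S c c' x y : tight S ->
  is_cycle (induced e S) c -> is_cycle (induced e S) c' ->
  x \in c -> (x, y) \in cycle_edges c' -> (x, y) \in cycle_edges c.
Proof.
move=> tS cy cy' xc xy; apply: contraT => N.
have ne : cycle_edges c <> cycle_edges c' by move=> E; rewrite E xy in N.
have /pred0P/(_ x) /= := tight_cycles_disjoint tS cy cy' ne.
by rewrite xc; case/andP: (cycle_edges_mem xy) => ->.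
Qed.

Lemma tight_pendant S u v : tight S -> pendant_in e S u -> v \in S -> e u v ->
  [/\ forall c, is_cycle (induced e S) c -> v \notin c, tight (S :\ u :\ v)
    & th (S :\ u :\ v) = th S].
Proof.
move=> tS pu vS euv.
have rp := rk_pendant se rphi pu vS euv; have r1 := rk_pendant se rpsi pu vS euv.
(* Deleting a cycle vertex [v] would keep the gain rank, but here it isolates the pendant [u] and so
   lowers that rank by 2. *)
have off c : is_cycle (induced e S) c -> v \notin c.
  move=> cy; apply/negP=> vc; have [_ E _ _] := tight_del_cycle tS cy vc.
  have := eq_rk phi (induced_pendant se pu vS euv); rk_lia.
have th1 : th (S :\ u :\ v) = th S.
  apply: induced_theta_sub => //; first by apply/subsetP=> w; rewrite !inE => /and3P[].
  move=> c cy w wc; rewrite !inE (cycle_in cy wc) andbT; apply/andP; split.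
    by apply: contraTneq wc => ->; apply: off.
  by apply: contraTneq wc => ->; apply: (pendant_off_cycle se pu).
split; [exact: off | | exact: th1].
by move/tightP: tS => tS; apply/tightP; rewrite th1; rk_lia.
Qed.

Lemma tight_delta_star S T : tight S -> delta_star e S T -> tight T.
Proof.
move=> + dT; elim: dT => // {S T} S S' T [u [v [pu vS euv ->]]] _ IH tS.
by apply: IH; case: (tight_pendant tS pu vS euv).
Qed.

(** * The structure forced by tightness *)

Definition good c : Prop := typeA phi c /\ (size c %% 4 = 2)%N.

Lemma typeA1 c : typeA psi c = (4 %| size c)%N.
Proof.
rewrite /typeA /cycle_gain big1 // eq_sym -signr_odd.
have -> : ((-1) ^+ odd (size c)./2 == 1 :> R[i]) = ~~ odd (size c)./2.
  by case: odd; rewrite ?expr1 ?expr0 ?eqxx // eqNr oner_eq0.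
have := odd_double_half (size c); have := odd_double_half (size c)./2.
by rewrite -!muln2; case: odd; case: odd => /=; lia.
Qed.

Lemma tight_closed_cycle S c : tight S -> closed_cycle e S c ->
  [/\ good c, tight (S :\: [set y in c]) & th S = th (S :\: [set y in c]) + 1].
Proof.
move=> tS cc; have [cy _] := cc; have [cye sub] := proj1 (induced_cycle e S c) cy.
have s2 : (2 < size c)%N by case/and3P: cy.
have [y yc] : exists y, y \in c by case: (c) s2 => // y c' _; exists y; rewrite inE eqxx.
have [ty rp r1 tE] := tight_del_cycle tS cy yc.
have thE : th (S :\: [set y in c]) = th (S :\ y).
  apply: induced_theta_sub => //.
    by apply/subsetP=> w; rewrite !inE => /andP[wc ->]; rewrite andbT; apply: contraNneq wc => ->.
  move=> c2 cy2 w wc2; have cy2' : is_cycle (induced e S) c2.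
    by apply: induced_cycle_sub cy2; apply: subD1set.
  rewrite !inE (cycle_in cy2' wc2) andbT; apply/negP=> wc.
  have yn : (y, next c y) \in cycle_edges c by rewrite in_cycle_edges yc eqxx.
  have ne : cycle_edges c <> cycle_edges c2.
    move=> E; move: yn; rewrite E => /cycle_edges_mem/andP[yc2 _].
    by have := cycle_in cy2 yc2; rewrite !inE eqxx.
  have /pred0P/(_ w) /= := tight_cycles_disjoint tS cy cy2' ne.
  by rewrite wc wc2.
have dp := rk_closed_cycle_del se rphi cc yc.
have d1 := rk_closed_cycle_del se rpsi cc yc.
have tc : tight (S :\: [set y in c]).
  by move/tightP: ty => ty; apply/tightP; rewrite thE; rk_lia.
split; [ | exact: tc | by rewrite thE].
have le1 := rk_closed_cycle_le se psi cc.
(* An odd cycle would have 0-1 rank [size c + 1], more than its number of rows. *)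
case: (boolP (odd (size c))) => oc.
  have cs := odd_half_pred_double oc.
  rewrite cs in d1; clear -le1 r1 d1 s2; rk_lia.
(* For even length the cycle has gain rank [size c - 2], hence Type A, and 0-1 rank [size c], so 4
   does not divide [size c]. *)
have cs := half_pred_double oc; rewrite cs in d1 dp.
have := rk_closed_cycle se rphi cc oc; have := rk_closed_cycle se rpsi cc oc.
rewrite typeA1 /good; clear -oc d1 dp rp r1 s2 => h1 h2.
split; last by move: h1; case: (boolP (4 %| size c)%N) => d4 /=; rk_lia.
by move: h2; case: typeA => //=; rk_lia.
Qed.

(** Conditions (2) and (3) for the induced subgraph; (1) follows from tightness through
    [tight_cycles_disjoint]. *)
Definition structured S : Prop :=
  (forall c, is_cycle (induced e S) c -> good c) /\
  exists S0 cs, [/\ delta_star e S S0, no_pendant e S0, (size cs)%:Z = th S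
                  & union_cycles_isolated e S0 cs].

Lemma structured_no_pendant S : no_pendant e S -> structured S ->
  exists2 cs, (size cs)%:Z = th S & union_cycles_isolated e S cs.
Proof.
move=> np [_ [S0 [cs [dS _ sz un]]]]; exists cs => //.
by rewrite -(no_pendant_delta_star np dS).
Qed.

(* Removing the only pendant vertex makes its neighbour the only possible pendant
   vertex, so one walks along a path until a vertex of degree at least 3, which
   would have to lie on a cycle. *)
Lemma tight_unique_pendant m : (forall T, (#|T| < m)%N -> tight T -> structured T) ->
  forall T x, (#|T| <= m)%N -> tight T -> pendant_in e T x ->
  (forall u, pendant_in e T u -> u = x) -> tight (T :\ x) -> False.
Proof.
move=> IH T; move kE: #|T| => k; elim: k T kE => [|k IHk] T kE x km tT px ux tx.
  have [v [xT _ _]] := pendantE px.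
  by move/eqP: kE; rewrite cards_eq0 => /eqP E; rewrite E inE in xT.
have [z [xT zT exz]] := pendantE px.
have ezx : e z x by rewrite (proj2 se).
have xz : x != z by apply: contraTneq exz => ->; rewrite (proj1 se).
have cx : #|T :\ x| = k by move: kE; rewrite (cardsD1 x T) xT => -[].
have [offz tz _] := tight_pendant tT px zT exz.
(* Only [z] loses a neighbour with [x], so no other vertex can become pendant. *)
have pT u : pendant_in e (T :\ x) u -> u = z.
  move=> pu; apply/eqP; apply: contraT => uz.
  have uTx : u \in T :\ x by case/andP: pu.
  have : pendant_in e T u.
    apply: pendant_ext pu; first exact: subD1set.
    move=> w wT euw; rewrite !inE wT andbT; apply/eqP=> E.
    move: euw; rewrite E (proj2 se) => exu.
    have uT : u \in T by move: uTx; rewrite !inE => /andP[].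
    by rewrite (pendant_uniq px zT exz uT exu) eqxx in uz.
  by move/ux=> E; move: uTx; rewrite E !inE eqxx.
(* If [z] becomes pendant, the situation repeats with [z] in place of [x]. *)
case: (boolP (pendant_in e (T :\ x) z)) => pz.
  by apply: (IHk (T :\ x) cx z) => //; apply: ltnW.
have np : no_pendant e (T :\ x).
  by move=> u; apply/negP=> pu; move: pz; rewrite -(pT u pu) pu.
(* Otherwise every remaining edge at [z] lies on a cycle, although [z], as the neighbour of a
   pendant vertex, lies on none. *)
have [|cs _ [Hc _ He]] := structured_no_pendant np (IH _ _ tx); first by rewrite cx.
have [w [wT ezw wx]] : exists w, [/\ w \in T, e z w & w != x].
  case: (pickP [pred w | [&& w \in T, e z w & w != x]]) => [w /and3P[]|no]; first by exists w.
  have pz' : pendant_in e T z.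
    apply: (pendantI zT xT ezx) => w wT ezw.
    by apply/eqP; have := no w; rewrite /= wT ezw /= => /negbFE.
  by rewrite (ux z pz') eqxx in xz.
have [] := He z w; rewrite ?inE ?zT ?wT ?wx 1?eq_sym ?xz // => /(_ ezw)[c cin zw] _.
have [cy sub] := Hc c cin.
have /negP[] : z \notin c; last by case/andP: (cycle_edges_mem zw).
apply: offz; apply/induced_cycle; split=> // v /sub.
by rewrite !inE => /andP[].
Qed.

(** * Tight graphs without pendant vertices *)

Lemma tight_no_bridge_closed S c : tight S -> (forall a b, ~~ bridge e S a b) ->
  is_cycle (induced e S) c -> closed_cycle e S c.
Proof.
move=> tS nb cy; split=> // x y xc xy.
have [c' cy' xy'] := nonbridge_cycle se xy (nb x y).
exact: (tight_cycle_edge tS cy cy' xc xy').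
Qed.

(** Each cycle is a component, so one can be split off; the rest is tight and without pendant
    vertices, and induction lists its cycles. *)
Lemma tight_no_bridge S : tight S -> no_pendant e S -> (forall a b, ~~ bridge e S a b) ->
  (forall T, (#|T| < #|S|)%N -> tight T -> structured T) -> structured S.
Proof.
move=> tS np nb IH; split.
  by move=> c cy; case: (tight_closed_cycle tS (tight_no_bridge_closed tS nb cy)).
exists S; case: (pickP (fun p : 'I_n * 'I_n => induced e S p.1 p.2)) => [[a b] /= ab|no]; last first.
  exists [::]; split; [exact: ds_refl | exact: np | |].
    rewrite acyclic_th // => -[|x c] //; apply/negP=> /and3P[_ _ cy].
    have : induced e S x (next (x :: c) x) by apply: next_cycle => //; rewrite inE eqxx.
    by have := no (x, next (x :: c) x) => /= ->.
  split=> // x y xS yS; split=> [exy|[]] //.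
  by have := no (x, y); rewrite /= /induced exy xS yS.
have [c cy abc] := nonbridge_cycle se ab (nb a b).
have cc := tight_no_bridge_closed tS nb cy.
have [_ tT thE] := tight_closed_cycle tS cc; set T := S :\: _ in tT thE.
have [_ cle] := cc; have [cye csub] := proj1 (induced_cycle e S c) cy.
have TS : T \subset S by apply: subsetDl.
have inT x : x \in T = (x \notin c) && (x \in S) by rewrite !inE.
have npT : no_pendant e T.
  move=> u; apply: contra (np u) => pu; apply: pendant_ext (pu) => // w wS euw.
  have := pu; case/andP; rewrite !inT => /andP[uc uS] _; rewrite wS andbT.
  apply: contra uc => wc.
  have : (w, u) \in cycle_edges c by apply: cle => //; apply/and3P; rewrite (proj2 se).
  by case/cycle_edges_mem/andP.
have cardT : (#|T| < #|S|)%N.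
  have /andP[ac _] := cycle_edges_mem abc.
  apply: proper_card; apply/properP; split=> //; exists a; first exact: csub.
  by rewrite inT ac.
have [cs sz [Hc Hd He]] := structured_no_pendant npT (IH _ cardT tT).
have dis j : (j < size cs)%N -> [disjoint c & nth [::] cs j].
  move=> jc; have [_ sub] := Hc _ (mem_nth [::] jc).
  apply/pred0P=> x /=; apply/negbTE/negP=> /andP[xc /sub].
  by rewrite inT xc.
exists (c :: cs); split; [exact: ds_refl | exact: np | by rewrite thE -sz /= -addn1 PoszD |].
split.
- move=> c'; rewrite inE => /orP[/eqP -> //|/Hc[cy' sub]]; split=> // x /sub.
  by rewrite inT => /andP[].
- move=> [|i] [|j] //= ic jc ij; first exact: dis.
    by rewrite disjoint_sym; apply: dis.
  by apply: Hd => // E; apply: ij; rewrite E.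
move=> x y xS yS; split=> [exy|[c']].
  case: (boolP (x \in c)) => xc.
    by exists c; [exact: mem_head | apply: cle => //; apply/and3P].
  case: (boolP (y \in c)) => yc.
    exists c; [exact: mem_head | rewrite cycle_edgesC; apply: cle => //].
    by apply/and3P; rewrite (proj2 se).
  have [] := He x y; rewrite ?inT ?xc ?yc // => /(_ exy)[c' c'in xy] _.
  by exists c'; rewrite // in_cons c'in orbT.
move=> c'in; apply: (is_cycle_edge (proj2 se)).
by move: c'in; rewrite inE => /orP[/eqP->//|/Hc[]].
Qed.

(** In the minimal side every edge but the bridge lies on a cycle. As [x] is not pendant it lies on
    some [c], and by disjointness all other edges at [c] belong to [c]. *)
Lemma tight_leaf_cycle S : tight S -> no_pendant e S -> (exists a b, bridge e S a b) ->
  exists c x z, [/\ is_cycle (induced e S) c, x \in c, z \in S :\: [set y in c], e x z &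
    forall a b, a \in c -> induced e S a b -> (a, b) = (x, z) \/ (a, b) \in cycle_edges c].
Proof.
move=> tS np /(minimal_bridge_side se)[z [x [D [bzx xD H]]]].
have /andP[/and3P[ezx zS xS] _] := bzx.
have exz : e x z by rewrite (proj2 se).
have [b [bS exb bz]] := not_pendantE np xS zS exz.
have xb : induced e S x b by apply/and3P.
have [[E]|[_ [c cy xbc]]] := H x b xD xb; first by rewrite E eqxx in bz.
have /andP[xc _] := cycle_edges_mem xbc.
have uc : uniq c by case/and3P: cy.
have offb a b' : (a, b') = (x, z) -> (a, b') \notin cycle_edges c.
  by move=> ->; apply: (bridge_off_cycle se) cy; rewrite bridgeC.
have cD : {subset c <= D}.
  move=> w wc; have := connect_cycle (cycle_next uc) xc wc.
  case/connectP=> p; elim: p (x) xc xD => [|t p IHp] s sc sD /=; first by move=> _ ->.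
  case/andP=> /eqP tE pp wE.
  have st : (s, t) \in cycle_edges c by rewrite in_cycle_edges sc tE eqxx.
  apply: (IHp t) => //; first by rewrite -tE mem_next.
  have [E|[]//] := H s t sD (is_cycle_edge (proj2 (induced_simple se S)) cy st).
  by have := offb _ _ E; rewrite st.
have Hc a b' : a \in c -> induced e S a b' -> (a, b') = (x, z) \/ (a, b') \in cycle_edges c.
  move=> ac ab; have [E|[_ [c' cy' ab']]] := H a b' (cD _ ac) ab; first by left.
  by right; apply: (tight_cycle_edge tS cy cy' ac ab').
exists c, x, z; split=> //; rewrite !inE zS andbT; apply/negP=> zc.
have zx : induced e S z x by apply/and3P.
have [[E _]|zxc] := Hc z x zc zx; first by rewrite E (proj1 se) in ezx.
by have := bridge_off_cycle se bzx cy; rewrite zxc.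
Qed.

(** Delta-transformations consume the path left by deleting a vertex of [c]. With [x] deleted, at
    most an isolated vertex remains. With a neighbour [y] of [x] deleted, [x] ends the path and
    survives, because an even number of vertices precedes it. *)
Lemma tight_leaf_cycle_del S c x z : tight S -> is_cycle (induced e S) c -> x \in c ->
  (forall a b, a \in c -> induced e S a b -> (a, b) = (x, z) \/ (a, b) \in cycle_edges c) ->
  tight (S :\: [set y in c]) /\
  (~~ odd (size c) -> tight (x |: (S :\: [set y in c]))).
Proof.
move=> tS cy xc Hc.
have uc : uniq c by case/and3P: cy.
have [cye csub] := proj1 (induced_cycle e S c) cy.
have edge a w : a \in c -> a != x -> w \in S -> e a w -> (a, w) \in cycle_edges c.
  move=> ac ax wS eaw; have [|[E _]|//] := Hc a w ac.
    by apply/and3P; rewrite csub.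
  by rewrite E eqxx in ax.
have [k q rE] := rot_to xc.
have cyr : is_cycle e (x :: q) by rewrite -rE is_cycle_rot.
have memr w : (w \in c) = (w \in x :: q) by rewrite -rE mem_rot.
have edr : cycle_edges (x :: q) = cycle_edges c by rewrite -rE cycle_edges_rot.
have /and3P[_ ur _] := cyr; have /andP[xq uq] := ur.
have qx w : w \in q -> w != x by move=> wq; apply: contraNneq xq => <-.
split.
  have [tx _ _ _] := tight_del_cycle tS cy xc.
  have cq : chain e (S :\ x) q.
    apply: (cycle_chain cyr).
    - by move=> w wq; rewrite !inE qx //= csub // memr inE wq orbT.
    - by rewrite !inE eqxx.
    - move=> a aq _ w; rewrite in_setD1 edr => /andP[_ wS] eaw.
      by apply: edge => //; [rewrite memr inE aq orbT | exact: qx].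
  have lq w : w \in S :\ x -> e (last x q) w -> w \in q.
    rewrite in_setD1 => /andP[wx wS] elw.
    have lN : last x q \in q by case: (q) cyr => [|y q'] // _; rewrite /= mem_last.
    have : (last x q, w) \in cycle_edges c.
      by apply: edge => //; [rewrite memr inE lN orbT | exact: qx].
    by case/cycle_edges_mem/andP=> _; rewrite memr inE (negbTE wx).
  have [T [dT iT _]] := chain_closed_delta_star se cq lq.
  have tT := tight_delta_star tx dT.
  apply: eq_tight tT => a b; rewrite iT; congr induced.
  apply/setP=> w; rewrite !inE memr inE negb_or.
  by case: (w == x); rewrite /= ?andbF.
move=> ec; case: q rE cyr memr edr ur xq uq qx => [|y q] rE cyr memr edr ur xq uq qx //.
have yc : y \in c by rewrite memr !inE eqxx orbT.
have [ty _ _ _] := tight_del_cycle tS cy yc.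
have rr : rot 1 [:: x, y & q] = y :: rcons q x by rewrite rot1_cons.
have cyy : is_cycle e (y :: rcons q x) by rewrite -rr is_cycle_rot.
have edy : cycle_edges (y :: rcons q x) = cycle_edges c by rewrite -rr cycle_edges_rot.
have /andP[yq _] := uq.
have yx : y != x by apply: qx; rewrite inE eqxx.
have cq : chain e (S :\ y) (rcons q x).
  apply: (cycle_chain cyy).
  - move=> w wq; rewrite !inE csub ?memr ?inE ?andbT.
      apply: contraTneq wq => ->; rewrite mem_rcons inE negb_or yq andbT.
      exact: yx.
    by move: wq; rewrite mem_rcons inE => /orP[] ->; rewrite ?orbT.
  - by rewrite !inE eqxx.
  - move=> a aq al w; rewrite in_setD1 edy => /andP[_ wS] eaw.
    rewrite last_rcons in al; apply: edge => //.
    by move: aq; rewrite mem_rcons memr !inE => /orP[] ->; rewrite ?orbT.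
have eq0 : ~~ odd (size q).
  by move: ec; rewrite -(size_rot k) rE /= negbK.
have cq0 : chain e (S :\ y) q by move: cq; rewrite -cats1; apply: chain_prefix.
have tT := tight_delta_star ty (chain_delta_star cq0 eq0).
apply: eq_tight tT => a b; congr induced.
apply/setP=> w; rewrite !inE memr !inE !negb_or.
case: (altP (w =P x)) => [->|wx] /=; last by case: (w == y); rewrite /= ?andbF.
move: xq; rewrite inE negb_or => /andP[xy xq]; rewrite xq xy.
by rewrite csub.
Qed.

Lemma tight_bridge_free S : tight S -> no_pendant e S ->
  (forall T, (#|T| < #|S|)%N -> tight T -> structured T) ->
  forall a b, ~~ bridge e S a b.
Proof.
move=> tS np IH a0 b0; apply/negP=> b00.
have [|c [x [z [cy xc zB exz Hc]]]] := tight_leaf_cycle tS np; first by exists a0, b0.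
have [tB tBx] := tight_leaf_cycle_del tS cy xc Hc.
have [cye csub] := proj1 (induced_cycle e S c) cy.
set B := S :\: _ in zB tB tBx.
have inB w : w \in B = (w \notin c) && (w \in S) by rewrite !inE.
have BS : B \subset S by apply: subsetDl.
have xS := csub _ xc.
have /andP[zc zS] : (z \notin c) && (z \in S) by rewrite -inB.
have ezx : e z x by rewrite (proj2 se).
have out u w : u \in B -> w \in c -> e u w -> u = z /\ w = x.
  rewrite inB => /andP[uc uS] wc euw; have [|[-> ->]|] // := Hc w u wc.
    by apply/and3P; rewrite (proj2 se) csub.
  by case/cycle_edges_mem/andP=> _ uc'; rewrite uc' in uc.
have cardB : (#|B| < #|S|)%N.
  by apply: proper_card; apply/properP; split=> //; exists x; rewrite // inB xc.
(* Only [z] has a neighbour on the removed cycle, so only [z] can be pendant in [B]. *)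
have pB u : pendant_in e B u -> u = z.
  move=> pu; apply/eqP; apply: contraT => uz.
  have uB : u \in B by case/andP: pu.
  have /negP[] := np u; apply: pendant_ext pu => // w wS euw.
  rewrite inB wS andbT; apply/negP=> wc.
  by case: (out u w uB wc euw) uz => ->; rewrite eqxx.
have [w [wS ezw wx]] := not_pendantE np zS xS ezx.
have zw : induced e B z w.
  apply/and3P; split=> //; rewrite inB wS andbT; apply/negP=> wc.
  by case: (out z w zB wc ezw) wx => _ ->; rewrite eqxx.
(* If [B] has a cycle, deleting a vertex of it leaves a smaller tight graph that still contains [c],
   and induction gives the parity. If not, [B] is a forest with an edge, and its only pendant vertex
   [z] contradicts [tight_unique_pendant]. *)
have ec : ~~ odd (size c).
  case: (cyclic_or_acyclic se B) => [[[|y c'] cy'] //|acB]; last first.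
    have [u pu] := acyclic_pendant se acB zw.
    have uz := pB u pu; rewrite uz in pu.
    case: (@tight_unique_pendant #|B| _ B z (leqnn _) tB pu pB).
      by move=> T TB; apply: IH; apply: ltn_trans TB cardB.
    apply: acyclic_tight => c'; apply: contra (acB c').
    by apply: induced_cycle_sub; apply: subD1set.
  have yc' : y \in y :: c' by rewrite inE eqxx.
  have := cycle_in cy' yc'; rewrite inB => /andP[yc yS].
  have cyS : is_cycle (induced e S) (y :: c') by apply: induced_cycle_sub cy'.
  have [ty _ _ _] := tight_del_cycle tS cyS yc'.
  have [G _] := IH _ (setD1_card_lt yS) ty.
  have [|/andP[] //] := G c.
  apply/induced_cycle; split=> // v vc; rewrite !inE csub // andbT.
  by apply: contraNneq yc => <-.
(* Putting [x] back makes it the only pendant vertex, while its deletion leads back to the tight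
   [B]. *)
set T := x |: B in tBx.
have inT v : v \in T = (v == x) || (v \in B) by rewrite !inE.
have TS : T \subset S by apply/subsetP=> v; rewrite inT => /orP[/eqP->//|]; apply: (subsetP BS).
have xB : x \notin B by rewrite inB xc.
have TxB : T :\ x = B by apply: setU1K.
have px : pendant_in e T x.
  apply: (pendantI (v := z)); rewrite ?inT ?eqxx ?zB ?orbT //.
  move=> v; rewrite inT => /orP[/eqP->|vB exv]; first by rewrite (proj1 se).
  by case: (out v x vB xc _) => //; rewrite (proj2 se).
apply: (@tight_unique_pendant #|T| _ T x (leqnn _) (tBx ec) px).
- move=> T' T'T; apply: IH; apply: leq_trans T'T _.
  exact: subset_leq_card.
- move=> u pu; apply/eqP; apply: contraT => ux.
  have uT : u \in T by case/andP: pu.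
  have uB : u \in B by move: uT; rewrite inT (negbTE ux).
  have /negP[] := np u; apply: pendant_ext pu => // v vS euv.
  rewrite inT inB vS andbT; case: (boolP (v \in c)) => vc; last by rewrite orbT.
  by case: (out u v uB vc euv) => _ ->; rewrite eqxx.
- by rewrite TxB.
Qed.

Lemma tight_structured S : tight S -> structured S.
Proof.
move mE: #|S| => m; elim/ltn_ind: m S mE => m IHm S mE tS.
have IH T : (#|T| < #|S|)%N -> tight T -> structured T.
  by rewrite mE => TS; apply: IHm TS _ erefl.
case: (pickP (pendant_in e S)) => [u pu|np]; last first.
  have np' : no_pendant e S by move=> u; rewrite np.
  by apply: tight_no_bridge => //; apply: tight_bridge_free.
have [v [uS vS euv]] := pendantE pu.
have [off tT thE] := tight_pendant tS pu vS euv.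
have cT : (#|S :\ u :\ v| < #|S|)%N.
  apply: leq_ltn_trans (setD1_card_lt uS); exact: subset_leq_card (subD1set _ _).
have [G [S0 [cs [dS np sz un]]]] := IH _ cT tT; split.
  move=> c cy; apply: G; have [cye sub] := proj1 (induced_cycle e S c) cy.
  apply/induced_cycle; split; first exact: cye.
  move=> w wc; rewrite !inE (sub _ wc) andbT; apply/andP; split.
    by apply: contraTneq wc => ->; apply: off.
  by apply: contraTneq wc => ->; apply: (pendant_off_cycle se pu).
exists S0, cs; split; [ | exact: np | by rewrite sz thE | exact: un].
by apply: ds_step dS; exists u, v.
Qed.

(** A good cycle of length [p] contributes [p - 2] to the gain rank, being of Type A, and [p] to the
    0-1 rank, as 4 does not divide [p]. *)
Lemma rk_union_cycles S cs : union_cycles_isolated e S cs ->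
  (forall c, c \in cs -> good c) -> rk e psi S = (rk e phi S + (size cs).*2)%N.
Proof.
elim: cs S => [|c cs IHcs] S [Hc Hd He] G.
  rewrite addn0; congr (\rank _); apply/matrixP=> i j; rewrite !mxE.
  by case: ifP => // /and3P[eij iS jS]; case: (proj1 (He i j iS jS) eij).
have [cye csub] := Hc c (mem_head _ _).
have dis c' x : c' \in cs -> x \in c -> x \notin c'.
  move=> c'in xc; apply/negP=> xc'.
  have ic : (index c' cs < size cs)%N by rewrite index_mem.
  have := Hd 0%N (index c' cs).+1 isT ic (fun E => ltac:(discriminate E)).
  by rewrite /= nth_index // => /pred0P/(_ x) /=; rewrite xc xc'.
have cc : closed_cycle e S c.
  split; first exact/induced_cycle.
  move=> x y xc /and3P[exy xS yS]; have [c'] := proj1 (He x y xS yS) exy.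
  rewrite in_cons => /orP[/eqP->//|c'in xy].
  by have := dis _ _ c'in xc; case/andP: (cycle_edges_mem xy) => ->.
have [tA s4] := G c (mem_head _ _).
have ec : ~~ odd (size c) by lia.
have s2 : (2 < size c)%N by case/and3P: cye.
have rp := rk_closed_cycle se rphi cc ec; have r1 := rk_closed_cycle se rpsi cc ec.
have n4 : (4 %| size c)%N = false by lia.
rewrite tA in rp; rewrite typeA1 n4 in r1.
have : rk e psi (S :\: [set y in c]) = (rk e phi (S :\: [set y in c]) + (size cs).*2)%N.
  apply: IHcs; last by move=> c' c'in; apply: G; rewrite in_cons c'in orbT.
  split.
  - move=> c' c'in; have [cy' sub] := Hc c' ltac:(by rewrite in_cons c'in orbT).
    split=> // x xc'; rewrite !inE sub // andbT.
    by apply/negP=> xc; have := dis _ _ c'in xc; rewrite xc'.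
  - by move=> i j ic jc ij; apply: (Hd i.+1 j.+1) => // -[].
  move=> x y; rewrite !inE => /andP[xc xS] /andP[yc yS]; rewrite He //; split.
    case=> c'; rewrite in_cons => /orP[/eqP->/cycle_edges_mem/andP[xc' _]|c'in xy].
      by rewrite xc' in xc.
    by exists c'.
  by case=> c' c'in xy; exists c'; rewrite // in_cons c'in orbT.
move: rp r1 s2 => /=; rewrite doubleS; clear; rk_lia.
Qed.

End Tight.

(** * The equivalence for unit gain graphs *)

Lemma unit_gain_reciprocal (R : rcfType) n (e : rel 'I_n) (phi : 'I_n -> 'I_n -> R[i]) :
  unit_gain e phi -> reciprocal e phi.
Proof.
by move=> ug i j /ug[n1 ->]; rewrite -normCK n1 expr1n.
Qed.

Theorem theorem4p8 (R : realType) (n : nat) (e : rel 'I_n)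
  (phi : 'I_n -> 'I_n -> R[i]) :
  simple_graph e -> unit_gain e phi ->
  ((\rank (gain_adj e phi))%:Z = (\rank (adj01 R e))%:Z - 2 * theta e <->
   [/\ (* (1) cycles pairwise vertex-disjoint *)
       (forall c1 c2, is_cycle e c1 -> is_cycle e c2 ->
          cycle_edges c1 <> cycle_edges c2 -> [disjoint c1 & c2]),
       (* (2) each cycle is of Type A with p = 2 mod 4 *)
       (forall c, is_cycle e c -> typeA phi c /\ (size c %% 4 = 2)%N)
     & (* (3) delta-transformations reach a crucial subgraph G0 which is the
          disjoint union of theta(G) cycles and isolated vertices *)
       (exists S0 : {set 'I_n}, exists cs : seq (seq 'I_n),
          [/\ delta_star e setT S0, no_pendant e S0,
              (size cs)%:Z = theta e & union_cycles_isolated e S0 cs])]).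
Proof.
move=> se ug; have rphi := unit_gain_reciprocal ug.
have iT := induced_setT e.
have rp : \rank (gain_adj e phi) = rk e phi setT.
  by congr (\rank _); apply/matrixP=> i j; rewrite !mxE iT.
have r1 : \rank (adj01 R e) = rk e (trivial_gain R (n := n)) setT.
  by congr (\rank _); apply/matrixP=> i j; rewrite !mxE iT.
have thE : theta e = induced_theta e setT by apply: eq_theta => x y; rewrite iT.
have cyT c : is_cycle e c -> is_cycle (induced e setT) c.
  by move=> cy; apply/induced_cycle; split; [exact: cy | move=> x _; rewrite inE].
rewrite rp r1 thE; split=> [/tightP tT|[_ G [S0 [cs [dS np sz un]]]]].
  have [G H] := tight_structured se rphi tT.
  split; last exact: H; last by move=> c /cyT/G.
  by move=> c1 c2 /cyT cy1 /cyT cy2; apply: (tight_cycles_disjoint se rphi tT).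
(* Delta-transformations lower both ranks equally, so their difference can be computed on [S0],
   where each cycle accounts for 2. *)
have dp := rk_delta_star se rphi dS.
have d1 := rk_delta_star se (@reciprocal1 R n e) dS.
have Gcs c : c \in cs -> good phi c by case: un => Hc _ _ /Hc[cy _]; apply: G.
have := rk_union_cycles se rphi un Gcs; rewrite -sz; clear -dp d1; rk_lia.
Qed.
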